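(* Let $Y_{2\omega}=\mathrm{as}\bigsqcup_{k=1}^{\infty}Y_{\omega+k}$ with $Y_{\omega+k}=\mathrm{as}\bigsqcup_{i=1}^{\infty}Y_{\omega+k}^{(i)}$ and $Y_{\omega+k}^{(i)}=\{(x_1,\ldots,x_i)\in(2^k\mathbb{Z})^i : |\{j : x_j\notin 2^i\mathbb{Z}\}|\leq k\}$. Let $g(r)=ad_{Y_{2\omega}}(r)+1$, and let $X_{\omega}(g)=\mathrm{as}\bigsqcup_{i=1}^{\infty}(2^{\tilde g(i)}\mathbb{Z})^{g(i)}$ with $\tilde g(r)=\max\{k\in\mathbb{N} : ad_{(2^k\mathbb{Z})^{g(r)}}(r)=g(r)\}$. Then $ad_{X_{\omega}(g)}(r)\geq g(r)>ad_{Y_{2\omega}}(r)$ for every $r>0$, while $\operatorname{trasdim}(Y_{2\omega})=2\operatorname{trasdim}(X_{\omega}(g))$.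
   Context: $\mathbb{N}=\{1,2,3,\ldots\}$; $\omega$ is the smallest infinite ordinal. For an ordinal $\alpha$, $2\alpha$ denotes $\alpha+\alpha$ (so $2\omega=\omega+\omega$). Families of subsets. Let $(X,d)$ be a metric space. For $r>0$, a family $\mathcal{U}$ of subsets of $X$ is $r$-disjoint if $d(U,V)=\inf\{d(x,y):x\in U,y\in V\}>r$ for all $U\neq V$ in $\mathcal{U}$. It is uniformly bounded if $\sup\{\operatorname{diam}U:U\in\mathcal{U}\}<\infty$. Transfinite asymptotic dimension. Let $Fin\,\mathbb{N}$ be the collection of all finite nonempty subsets of $\mathbb{N}$. For $M\subseteq Fin\,\mathbb{N}$ and $\sigma\in\{\varnothing\}\cup Fin\,\mathbb{N}$ let $M^{\sigma}=\{\tau\in Fin\,\mathbb{N}:\tau\cup\sigma\in M,\ \tau\cap\sigma=\varnothing\}$, and $M^a=M^{\{a\}}$ for $a\in\mathbb{N}$. Define $\operatorname{Ord}M$ inductively: $\operatorname{Ord}M=0$ iff $M=\varnothing$; $\operatorname{Ord}M\leq\alpha$ (for an ordinal $\alpha>0$) iff $\operatorname{Ord}M^a<\alpha$ for every $a\in\mathbb{N}$; $\operatorname{Ord}M=\alpha$ iff $\operatorname{Ord}M\leq\alpha$ and $\operatorname{Ord}M<\alpha$ is not true; $\operatorname{Ord}M=\infty$ iff $\operatorname{Ord}M\leq\alpha$ holds for no ordinal $\alpha$. For a metric space $X$, let $A(X)$ be the set of $\sigma\in Fin\,\mathbb{N}$ for which there are no uniformly bounded families $\mathcal{U}_i$ ($i\in\sigma$)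 of subsets of $X$ such that each $\mathcal{U}_i$ is $i$-disjoint and $\bigcup_{i\in\sigma}\mathcal{U}_i$ covers $X$. Then $\operatorname{trasdim}(X)=\operatorname{Ord}A(X)$. Asymptotic dimension function. For a cover $\mathcal{U}$ of a metric space $X$, the Lebesgue number is $L(\mathcal{U})=\inf_{x\in X}\sup\{r>0:\exists U\in\mathcal{U},\ B(x,r)\subseteq U\}$, and the multiplicity $m(\mathcal{U})$ is the maximal number of elements of $\mathcal{U}$ with a nonempty intersection. Then $ad_X(\lambda)=\min\{m(\mathcal{U}):\mathcal{U}\text{ is a uniformly bounded cover of }X\text{ with }L(\mathcal{U})\geq\lambda\}-1$. Asymptotic union. For a sequence $\{Z_i\}_{i=1}^\infty$ of subspaces of a metric space $(Z,d_Z)$, the asymptotic union $\mathrm{as}\bigsqcup_{i=1}^{\infty}Z_i$ is the disjoint union of the $Z_i$ with the metric given, for $x$ in the $l$-th summand $Z_l$ and $y$ in the $k$-th summand $Z_k$ with $l\leq k$, by $d(x,y)=d_Z(x,y)+c$, where $c=0$ if $l=k$ and $c=l+(l+1)+\cdots+(k-1)$ if $l<k$. Ambient spaces. $\mathbb{R}^j$ is regarded as a subspace of $(\bigoplus\mathbb{R},d_{\max})$, the space of finitely supported real sequences with the max metric ($\mathbb{R}^j$ being the sequences vanishing after the $j$-th coordinate); the spaces $(2^k\mathbb{Z})^n\subset\mathbb{R}^n$ are subspaces of it. Each $Y_{\omega+k}$ is a subspace of $\mathrm{as}\bigsqcup_{j=1}^{\infty}\mathbb{R}^j$ (with $Y_{\omega+k}^{(i)}\subset\mathbb{R}^i$),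 and $Y_{2\omega}$ is the asymptotic union of the sequence $\{Y_{\omega+k}\}_{k\ge1}$ of subspaces of $Z=\mathrm{as}\bigsqcup_{j=1}^{\infty}\mathbb{R}^j$.
   Formalization: The inequality ad_{X_ω(g)}(r) ≥ g(r) is stated for r > 1 only: for 0 < r ≤ 1 it fails, as X_ω(g) is 1-discrete, so ad = 0 < g(r). The maxima g̃(1), g̃(2) are over empty sets and are taken to be 0, so the first two summands are Z. *)

(* Defs.v *)
From HB Require Import structures.
From mathcomp Require Import all_boot all_order all_algebra finmap.
From mathcomp Require Import zify lra.
From mathcomp Require Import all_classical all_reals all_analysis.

Set Implicit Arguments.
Unset Strict Implicit.
Unset Printing Implicit Defensive.

Import Order.TTheory GRing.Theory Num.Theory.

Local Open Scope classical_set_scope.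
Local Open Scope card_scope.
Local Open Scope ring_scope.

(* [tosup f] denotes the least ordinal strictly above all the [f i].  Every
   ordinal is of this form (it is the strict supremum of its elements, i.e. of
   the smaller ordinals); distinct trees may denote the same ordinal, so
   equality of ordinals is [toeq].  (The library's [ordinal] is ['I_n].) *)
Inductive tord : Type := tosup (A : Type) (f : A -> tord).

Fixpoint tole (a b : tord) {struct a} : Prop :=
  match a, b with
  | tosup A f, tosup B g => forall i : A, exists j : B, tole (f i) (g j)
  end.

Definition tolt (a b : tord) : Prop :=
  match b with tosup B g => exists j : B, tole a (g j) end.

Definition toeq (a b : tord) : Prop := tole a b /\ tole b a.

Definition tozero : tord := tosup (fun i : void => match i with end).

(* a + b is the strict supremum of the ordinals below a together with the
   a + c for c < b. *)
Fixpoint toadd (a b : tord) {struct b} : tord :=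
  match a, b with
  | tosup A f, tosup B g =>
      tosup (fun s : A + B => match s with
                              | inl i => f i
                              | inr j => toadd a (g j)
                              end)
  end.

Lemma tole_refl a : tole a a.
Proof. by elim: a => A f IH /= i; exists i. Qed.

Lemma tole_trans b a c : tole a b -> tole b c -> tole a c.
Proof.
elim: a b c => A f IH [B g] [C h] /= ab bc i.
have [j fg] := ab i; have [k gh] := bc j; exists k; exact: IH fg gh.
Qed.

Lemma tolt_wf : well_founded tolt.
Proof.
suff H b a : tole a b -> Acc tolt a by move=> a; apply: (H a); exact: tole_refl.
elim: b a => B g IH [A f] /= ab; constructor => c /= [i ci].
by have [j fg] := ab i; apply: (IH j); exact: tole_trans ci fg.
Qed.

Lemma tolt_nle a b : tolt a b <-> ~ tole b a.
Proof.
split.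
- move=> ab ba.
  have H : tolt a a.
    case: b ab ba => B g [j agj]; case: a agj => A f agj /= /(_ j)[i gf].
    by exists i; exact: tole_trans agj gf.
  have irr c : ~ tolt c c.
    by elim/(well_founded_induction tolt_wf): c => c IH cc; exact: (IH c cc cc).
  exact: irr H.
- elim: b a => B g IH [A f] /= /existsNP[j nj]; exists j.
  have H i : tolt (f i) (g j) by apply: IH => gf; apply: nj; exists i.
  by case: (g j) H.
Qed.

(* A subspace of X is [set_type S] for [S : set X]; the library gives it the
   induced pseudometric, whose distance is that of X. *)
Section subspace_metric.
Context {R : realType} {X : metricType R} (S : set X).

Let sub_mdist (x y : S) : R := mdist (set_val x) (set_val y).

Let sub_mdist_ge0 x y : 0 <= sub_mdist x y. Proof. exact: mdist_ge0. Qed.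

Let sub_mdist_pos x y : sub_mdist x y = 0 -> x = y.
Proof. by move=> /mdist_positivity /val_inj. Qed.

Let sub_ballE (x : S) d : ball x d = [set y | sub_mdist x y < d].
Proof.
apply/seteqP; split => y; rewrite /ball/= /initial_ball ballEmdist//=.
Qed.

HB.instance Definition _ := @PseudoMetric_isMetric.Build R (set_type S)
  sub_mdist sub_mdist_ge0 sub_mdist_pos sub_ballE.

End subspace_metric.

(* Finitely supported real sequences with the max metric; the index [m : nat]
   stands for the (m+1)-st coordinate. *)
Definition finseq (R : realType) : Type := {fsfun nat -> R with 0}.

HB.instance Definition _ (R : realType) := Choice.on (finseq R).

Section finseq_metric.
Context {R : realType}.
Implicit Types x y z : finseq R.

Let dmax x y : R :=
  \big[Num.max/0]_(m <- (finsupp x `|` finsupp y)%fset) `|x m - y m|.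

Let dmax_ge0 x y : 0 <= dmax x y.
Proof. exact: bigmax_ge_id. Qed.

Let le_dmax x y m : `|x m - y m| <= dmax x y.
Proof.
have [mI|] := boolP (m \in (finsupp x `|` finsupp y)%fset).
  exact: le_bigmax_seq mI _.
by rewrite in_fsetU negb_or => /andP[/fsfun_dflt -> /fsfun_dflt ->];
  rewrite subrr normr0.
Qed.

Let dmax_le x y c : 0 <= c -> (forall m, `|x m - y m| <= c) -> dmax x y <= c.
Proof. by move=> c0 H; apply: bigmax_le. Qed.

Let dmaxxx x : dmax x x = 0.
Proof.
apply/eqP; rewrite eq_le dmax_ge0 andbT; apply: dmax_le => // m.
by rewrite subrr normr0.
Qed.

Let dmax_pos x y : dmax x y = 0 -> x = y.
Proof.
move=> d0; apply/fsfunP => m; apply/eqP; rewrite -subr_eq0.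
by have := le_dmax x y m; rewrite d0 normr_le0.
Qed.

Let dmax_sym x y : dmax x y = dmax y x.
Proof.
by rewrite /dmax fsetUC; apply: eq_bigr => m _; rewrite distrC.
Qed.

Let dmax_tri y x z : dmax x z <= dmax x y + dmax y z.
Proof.
apply: dmax_le => [|m]; first exact: addr_ge0.
by rewrite (le_trans (ler_distD (y m) _ _))// lerD.
Qed.

HB.instance Definition _ :=
  @isMetric.Build R (finseq R) dmax dmaxxx dmax_pos dmax_sym dmax_tri.

Lemma finseq_mdistE x y : mdist x y =
  \big[Num.max/0]_(m <- (finsupp x `|` finsupp y)%fset) `|x m - y m|.
Proof. by []. Qed.

End finseq_metric.

Section asymptotic_union.
Context {R : realType} {Z : metricType R} (S : nat -> set Z).

(* The summands are indexed by i = 1, 2, ...: a point is a pair (i, x) with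
   1 <= i and x in S i.  The value S 0 is not used. *)
Definition asunion : Type :=
  set_type [set p : nat * Z | (0 < p.1)%N /\ S p.1 p.2].

HB.instance Definition _ := Choice.on asunion.

Definition as_idx (p : asunion) : nat := (set_val p).1.
Definition as_pt (p : asunion) : Z := (set_val p).2.

Definition as_gap (l k : nat) : nat := \sum_(minn l k <= j < maxn l k) j.

Let as_dist (p q : asunion) : R :=
  mdist (as_pt p) (as_pt q) + (as_gap (as_idx p) (as_idx q))%:R.

Let as_gap_tri k l m : (as_gap l m <= as_gap l k + as_gap k m)%N.
Proof.
pose T n := (\sum_(0 <= j < n) j)%N.
have TD a b : (a <= b)%N -> (T a + \sum_(a <= j < b) j)%N = T b.
  by move=> ab; rewrite /T [RHS](big_cat_nat (n := a)).
have Tm a b : (a <= b)%N -> (T a <= T b)%N by move=> /TD <-; exact: leq_addr.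
have gT a b : as_gap a b = (T a - T b + (T b - T a))%N.
  have [ab|ab] := leqP a b; [|move/ltnW: ab => ab].
    by rewrite /as_gap (minn_idPl ab) (maxn_idPr ab);
    have := Tm _ _ ab; have := TD _ _ ab; lia.
  by rewrite /as_gap (minn_idPr ab) (maxn_idPl ab);
    have := Tm _ _ ab; have := TD _ _ ab; lia.
by rewrite !gT; lia.
Qed.

Let as_distxx p : as_dist p p = 0.
Proof. by rewrite /as_dist mdistxx /as_gap minnn maxnn big_geq// addr0. Qed.

Let as_dist_pos p q : as_dist p q = 0 -> p = q.
Proof.
move=> /eqP; rewrite /as_dist paddr_eq0 ?mdist_ge0 ?ler0n// pnatr_eq0.
case/andP => /eqP/mdist_positivity pq /eqP g0; apply: val_inj.
have : as_idx p = as_idx q.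
  have p0 : (0 < as_idx p)%N by have := set_valP p; case.
  have q0 : (0 < as_idx q)%N by have := set_valP q; case.
  have gap0 a b : (0 < a)%N -> (a < b)%N -> (0 < as_gap a b)%N.
    move=> a0 ab; rewrite /as_gap (minn_idPl (ltnW ab)) (maxn_idPr (ltnW ab)).
    by rewrite big_ltn// addn_gt0 a0.
  have [pq1|pq1|//] := ltngtP (as_idx p) (as_idx q).
    by have := gap0 _ _ p0 pq1; rewrite g0.
  by have := gap0 _ _ q0 pq1; rewrite /as_gap minnC maxnC -/(as_gap _ _) g0.
by move: pq; rewrite /as_idx /as_pt -!set_valE;
  case: (set_val p) (set_val q) => [? ?] [? ?] /= -> ->.
Qed.

Let as_dist_sym p q : as_dist p q = as_dist q p.
Proof. by rewrite /as_dist metric_sym /as_gap minnC maxnC. Qed.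

Let as_dist_tri q p r : as_dist p r <= as_dist p q + as_dist q r.
Proof.
rewrite /as_dist addrACA -natrD lerD ?metric_triangle//.
by rewrite ler_nat as_gap_tri.
Qed.

HB.instance Definition _ :=
  @isMetric.Build R asunion as_dist as_distxx as_dist_pos as_dist_sym as_dist_tri.

Lemma as_mdistE (p q : asunion) :
  mdist p q = mdist (as_pt p) (as_pt q) + (as_gap (as_idx p) (as_idx q))%:R.
Proof. by []. Qed.

End asymptotic_union.

Section families.
Context {R : realType} {X : metricType R}.
Implicit Types (U : set (set X)) (A B : set X).

Definition set_dist A B : \bar R :=
  ereal_inf [set (mdist p.1 p.2)%:E | p in [set p : X * X | A p.1 /\ B p.2]].

Definition diam A : \bar R :=
  ereal_sup [set (mdist p.1 p.2)%:E | p in [set p : X * X | A p.1 /\ A p.2]].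

Definition disjoint_family (r : R) U : Prop :=
  forall A B, U A -> U B -> A <> B -> (r%:E < set_dist A B)%E.

Definition uniformly_bounded U : Prop :=
  (ereal_sup [set diam A | A in U] < +oo)%E.

Definition is_cover U : Prop := \bigcup_(A in U) A = setT.

(* Because of the inner supremum, open and closed balls give the same value. *)
Definition lebesgue_number U : \bar R :=
  ereal_inf [set ereal_sup [set r%:E | r in
      [set r : R | 0 < r /\ exists2 A, U A & ball x r `<=` A]]
    | x in [set: X]].

(* The supremum, possibly +oo, of the n such that some n distinct elements of
   U have a common point. *)
Definition multiplicity U : \bar R :=
  ereal_sup [set n%:R%:E | n in [set n : nat | exists F : set (set X),
    [/\ F `<=` U, F #= `I_n & \bigcap_(A in F) A !=set0]]].

End families.

(* ad_X(l), in the extended reals; it is +oo when no admissible cover has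
   finite multiplicity.  The multiplicities belong to {0, 1, ..., +oo}, so the
   infimum is a minimum. *)
Definition ad {R : realType} (X : metricType R) (l : R) : \bar R :=
  (ereal_inf [set multiplicity U | U in [set U : set (set X) |
     [/\ is_cover U, uniformly_bounded U & l%:E <= lebesgue_number U]]] - 1)%E.

Definition FinN : set {fset nat} :=
  [set s | s <> fset0 /\ forall i, i \in s -> (0 < i)%N].

Definition link (M : set {fset nat}) (s : {fset nat}) : set {fset nat} :=
  [set t | [/\ FinN t, M (t `|` s)%fset & (t `&` s)%fset = fset0]].

(* Ord M <= a, with b < a witnessing each Ord M^i < a; the positive integers i
   are the elements of the index set. *)
Inductive Ord_le : set {fset nat} -> tord -> Prop :=
| Ord_le_zero M a : toeq a tozero -> M = set0 -> Ord_le M a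
| Ord_le_pos M a : tolt tozero a ->
    (forall i : nat, (0 < i)%N ->
       exists2 b, tolt b a & Ord_le (link M [fset i]%fset) b) ->
    Ord_le M a.

Definition Ord_lt (M : set {fset nat}) (a : tord) : Prop :=
  exists2 b, tolt b a & Ord_le M b.

(* [Ord_eq M a] is Ord M = a; Ord M is infinite when this holds for no a. *)
Definition Ord_eq (M : set {fset nat}) (a : tord) : Prop :=
  Ord_le M a /\ ~ Ord_lt M a.

Definition Acoll {R : realType} (X : metricType R) : set {fset nat} :=
  [set s | FinN s /\ ~ exists U : nat -> set (set X),
     (forall i, i \in s ->
        uniformly_bounded (U i) /\ disjoint_family i%:R (U i)) /\
     is_cover (\bigcup_(i in [set` s]) U i)].

Definition trasdim_eq {R : realType} (X : metricType R) (a : tord) : Prop :=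
  Ord_eq (Acoll X) a.

Section spaces.
Variable R : realType.

Definition pow2Z (k : nat) : {pred R} := [pred x | x / 2 ^+ k \is a Num.int].

Definition Rn (j : nat) : set (finseq R) :=
  [set x | forall m, (j <= m)%N -> x m = 0].

Definition pow2Zn (k n : nat) : set (finseq R) :=
  [set x | Rn n x /\ forall m, (m < n)%N -> x m \in pow2Z k].

Definition asRn : metricType R := asunion Rn.

Definition Ywk_part (k i : nat) : set (finseq R) :=
  [set x | pow2Zn k i x /\
           (#|[pred m : 'I_i | x m \notin pow2Z i]| <= k)%N].

(* Y_(w+k), the asymptotic union over i of the Y_(w+k)^(i), as a subspace of
   the asymptotic union of the R^i. *)
Definition Ywk (k : nat) : set asRn := [set p | Ywk_part k (as_idx p) (as_pt p)].

Definition Y2w : metricType R := asunion Ywk.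

(* The natural number ad(r) + 1; the default 0 would only be returned if the
   value were infinite. *)
Definition g_fun (r : R) : nat :=
  xget 0%N [set n : nat | n%:R%:E = (ad Y2w r + 1)%E].

(* 0 if there is no maximum.  For [g_tilde] this happens at r <= 2, where no
   k >= 1 qualifies (2^k Z is r-discrete); the first two summands of [Xw] are
   then powers of Z. *)
Definition maxnat (A : set nat) : nat :=
  xget 0%N [set k | A k /\ forall j, A j -> (j <= k)%N].

Definition g_tilde (g : R -> nat) (r : R) : nat :=
  maxnat [set k : nat | (0 < k)%N /\
    ad (set_type (pow2Zn k (g r)) : metricType R) r = (g r)%:R%:E].

Definition Xw (g : R -> nat) : metricType R :=
  asunion (fun i : nat => pow2Zn (g_tilde g i%:R) (g i%:R)).

End spaces.

(* Main.v *)
Require Import Defs.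
From HB Require Import structures.
From mathcomp Require Import all_boot all_order all_algebra finmap.
From mathcomp Require Import zify ring lra.
From mathcomp Require Import all_classical all_reals all_analysis.

(** The lower bounds all come from a discrete Lebesgue covering theorem: if the
points of [0, N]^n are labelled so that no label meets two opposite faces, then
some unit cube carries n + 1 labels.  It is Sperner's lemma for the Kuhn
triangulation, obtained by iterating the prism operator on chains mod 2.  The
upper bounds come from one family of slab coverings: cut R into intervals of
length L, coloured cyclically with Q colours; the points of R^n none of whose
coordinates has colour c form a family of L-separated boxes of size at most QL,
and with more colours than the coordinates can use these families cover.

Applied to (2^k Z)^n this gives ad(r) = n for r > 2^k, hence g~(i) -> oo, both
estimates on ad, and trasdim X_w(g) = w.  For trasdim Y_2w >= 2w one must show
that k families that are only 2^k-disjoint and m families that are disjoint at a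
scale far above 2^i do not cover the k-skeleton of the grid 2^i Z^n, n = k + m.
Such a covering would extend to an n-colouring of the whole cube: points near the
k-skeleton are rounded to it, and the remaining points, grouped by the dimension
d > k of the face they are close to the interior of, get the coarse colour
number d - k; a coarse colour sees each face as a single point, so all colour
components remain bounded, against the covering theorem. *)

Set Implicit Arguments.
Unset Strict Implicit.
Unset Printing Implicit Defensive.

Import Order.TTheory GRing.Theory Num.Theory.

Local Open Scope classical_set_scope.
Local Open Scope card_scope.
Local Open Scope ring_scope.

(** * The discrete Lebesgue covering theorem *)

Section covering_theorem.
Local Open Scope nat_scope.

Lemma all_flatten (T : Type) (a : pred T) ss : all a (flatten ss) = all (all a) ss.
Proof. by elim: ss => //= s ss IH; rewrite all_cat IH. Qed.

Lemma all_true (T : Type) (a : pred T) s : (forall x, a x) -> all a s.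
Proof. by move=> aT; elim: s => //= x s ->; rewrite aT. Qed.

(** Facets of an ordered simplex, in the order of the omitted vertex; chains are taken mod 2, so
    facets carry no signs. *)
Fixpoint bd (T : Type) (s : seq T) : seq (seq T) :=
  if s is x :: s' then s' :: map (cons x) (bd s') else [::].

Lemma bd_map (T T' : Type) (q : T -> T') s : bd (map q s) = map (map q) (bd s).
Proof. by elim: s => //= x s ->; rewrite -!map_comp. Qed.

(** * Chains mod 2 and the prism operator *)

Section chains.
Variable T : Type.
Implicit Types (s : seq T) (c : seq (seq T)) (f : seq T -> bool).

(** The standard triangulation of the prism swept out between the images of [s] under [p] and [q]:
    the simplices [p x_0 .. p x_i q x_i .. q x_n]. *)
Fixpoint prism (p q : T -> T) s : seq (seq T) :=
  if s is x :: s' then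
    (p x :: q x :: map q s') :: map (cons (p x)) (prism p q s')
  else [::].

(** Chains mod 2 are compared through their pairings with all cochains [f], so that repeated
    simplices cancel without any normal form. *)
Definition ev f c : bool := \big[addb/false]_(s <- c) f s.

Lemma ev_cat f c c' : ev f (c ++ c') = ev f c (+) ev f c'.
Proof. by rewrite /ev big_cat. Qed.

Lemma ev_nil f : ev f [::] = false.
Proof. by rewrite /ev big_nil. Qed.

Lemma ev_cons f s c : ev f (s :: c) = f s (+) ev f c.
Proof. by rewrite /ev big_cons. Qed.

Lemma ev_map f (h : seq T -> seq T) c : ev f (map h c) = ev (f \o h) c.
Proof. by rewrite /ev big_map. Qed.

Lemma ev_flatten (I : Type) f (F : I -> seq (seq T)) r :
  ev f (flatten (map F r)) = \big[addb/false]_(i <- r) ev f (F i).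
Proof.
elim: r => [|i r IH] /=; first by rewrite ev_nil big_nil.
by rewrite ev_cat IH big_cons.
Qed.

(** The homotopy formula: boundary of prism plus prism of boundary is [q] plus [p]. The prism over
    [x :: s] is one new simplex and the cone from [p x] over the prism over [s]; [E1] is the
    boundary of that cone, [E2] the prism over the facets that keep [x]. *)
Lemma bd_prism p q s f :
  ev f (flatten (map (@bd T) (prism p q s))) =
  f (map q s) (+) f (map p s) (+) ev f (flatten (map (prism p q) (bd s))).
Proof.
elim: s f => [|x s IH] f /=; first by rewrite !ev_nil addbb.
have E1 : ev f (flatten (map (@bd T) (map (cons (p x)) (prism p q s)))) =
    ev f (prism p q s) (+) ev (f \o cons (p x)) (flatten (map (@bd T) (prism p q s))).
  rewrite -map_comp; elim: (prism p q s) => [|t c IHc]; first by rewrite /= !ev_nil.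
  rewrite /= !ev_cons !ev_cat !ev_map IHc.
  by case: (f t); case: (ev f c); case: (ev _ _); case: (ev _ _).
have E2 : ev f (flatten (map (prism p q) (map (cons x) (bd s)))) =
    ev (f \o cons (p x) \o cons (q x) \o map q) (bd s) (+)
    ev (f \o cons (p x)) (flatten (map (prism p q) (bd s))).
  rewrite -map_comp; elim: (bd s) => [|t c IHc]; first by rewrite /= !ev_nil.
  rewrite /= !ev_cons !ev_cat !ev_map IHc /=.
  by case: (f _); case: (ev _ _); case: (ev _ _); case: (ev _ _).
rewrite !(ev_cons, ev_cat) E1 IH E2 !ev_map bd_map !ev_map /=.
rewrite /comp /=.
case: (f (q x :: _)); case: (f (p x :: [seq q i | i <- s]));
  case: (f (p x :: [seq p i | i <- s])); case: (ev f (prism p q s));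
  case: (ev _ _); by case: (ev _ _).
Qed.

End chains.

(** A facet and its omitted vertex together are a permutation of [l], so facets can be counted by
    their omitted vertices. *)
Lemma facets_perm (l t : seq nat) :
  count (fun q => perm_eq q t) (bd l) = count (fun x => perm_eq (x :: t) l) l.
Proof.
have Hz (s : seq nat) : all (fun p => perm_eq (p.1 :: p.2) s) (zip s (bd s)).
  elim: s => //= x s IH; rewrite perm_refl /=.
  have -> : zip s (map (cons x) (bd s)) =
      [seq (p.1, x :: p.2) | p <- zip s (bd s)].
    by elim: s (bd s) {IH} => [|y s IH] [|c cs] //=; rewrite IH.
  rewrite all_map; apply: sub_all IH => p /= H.
  have -> : perm_eq [:: p.1, x & p.2] (x :: s) = perm_eq [:: x, p.1 & p.2] (x :: s).
    by apply: (permPl _); rewrite (perm_catCA [:: _] [:: _]).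
  by rewrite perm_cons.
have sz (s : seq nat) : size (bd s) = size s.
  by elim: s => //= x s IH; rewrite size_map IH.
rewrite -[in LHS](@unzip2_zip _ _ l (bd l)) ?sz//.
rewrite -[in X in _ = count _ X](@unzip1_zip _ _ l (bd l)) ?sz// !count_map.
apply: eq_in_count => p pin /=.
have H := allP (Hz l) _ pin.
rewrite -(permPr H) perm_cons perm_sym //.
Qed.

Lemma count_oddE (T : Type) (a : pred T) s : odd (count a s) = \big[addb/false]_(x <- s) a x.
Proof. by elim: s => [|x s IH]; rewrite ?big_nil // big_cons /= oddD IH; case: (a x). Qed.

(** If some facet has the labels 0, ..., k and [x0] is the label left out, the number of such facets
    is the multiplicity of [x0] in [l]: one if [x0] is [k.+1], two otherwise. *)
Lemma sperner_simplex k (l : seq nat) :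
  all (fun v => v <= k.+1) l ->
  odd (count (fun q => perm_eq q (iota 0 k.+1)) (bd l)) =
  perm_eq l (iota 0 k.+2).
Proof.
move=> lk; rewrite facets_perm.
set t := iota 0 k.+1.
have tS : perm_eq (k.+1 :: t) (iota 0 k.+2).
  by rewrite -[k.+2]addn1 iotaD add0n cats1 perm_sym perm_rcons.
have [/hasP[x0 x0l px]|no] := boolP (has (fun x => perm_eq (x :: t) l) l); last first.
  move: (no); rewrite has_count -leqNgt leqn0 => /eqP ->; apply/esym/negP => pl.
  move/negP: no; apply; apply/hasP; exists k.+1.
    by rewrite (perm_mem pl) mem_iota; lia.
  by rewrite (permPl tS) perm_sym.
have cE x : perm_eq (x :: t) l = (x == x0).
  rewrite -(permPr px); apply/idP/eqP => [/permP/(_ (pred1 x))|-> //] /=.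
  by rewrite eqxx; case: eqP => [->//|_]; lia.
rewrite (eq_count cE).
have cu (m : nat) : count (pred1 x0) (iota 0 m) = (x0 < m) :> nat.
  by rewrite (count_uniq_mem _ (iota_uniq _ _)) mem_iota.
have cc y s : count (pred1 x0) (y :: s) = (y == x0) + count (pred1 x0) s by [].
have cl : count (pred1 x0) l = (x0 <= k).+1.
  by move/permP: px => /(_ (pred1 x0)) <-; rewrite cc eqxx cu.
have x0k := allP lk _ x0l.
rewrite -[LHS]/(odd (count (pred1 x0) l)) cl -(permPl px).
have [x0k'|x0k'] := leqP x0 k; last first.
  by have -> : x0 = k.+1 by lia; rewrite tS.
apply/esym/negP => /permP/(_ (pred1 x0)); rewrite cu.
by rewrite cc eqxx cu; lia.
Qed.

(** * The Kuhn triangulation of the box and Sperner's lemma for it *)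

Section box.
Variable N : nat.
Notation point := (nat -> nat).

Definition upd (n t : nat) (x : point) : point := fun j => if j == n then t else x j.

Definition step n t (s : seq point) := prism (upd n t) (upd n t.+1) s.

(** The Kuhn triangulation of [0, N]^n: each slab between heights t and t + 1 in the last coordinate
    is the prism over the triangulation in one dimension less. *)
Fixpoint box_chain n : seq (seq point) :=
  if n is n'.+1 then
    flatten [seq flatten (map (step n' t) (box_chain n')) | t <- iota 0 N]
  else [:: [:: fun=> 0]].

Definition box_top n : seq (seq point) :=
  if n is n'.+1 then map (map (upd n' N)) (box_chain n') else [::].

(* The boundary of [box_chain n] without the face [box_top n], where Sperner labels of
   dimension n - 1 live. *)
Fixpoint box_sides n : seq (seq point) :=
  if n is n'.+1 then
    map (map (upd n' 0)) (box_chain n') ++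
    flatten [seq flatten (map (step n' t) (box_sides n' ++ box_top n')) | t <- iota 0 N]
  else [:: [::]].

(** By the homotopy formula a slab is bounded by its floor, its ceiling and the prism over the
    boundary of the lower box; the ceiling of each slab cancels the floor of the next. *)
Lemma bd_box_chain n f :
  ev f (flatten (map (@bd point) (box_chain n))) = ev f (box_sides n) (+) ev f (box_top n).
Proof.
elim: n f => [|n IH] f /=; first by rewrite !ev_cons ev_nil; case: (f _).
have flat (c : seq (seq point)) t :
    ev f (flatten (map (step n t) c)) = ev (fun s => ev f (step n t s)) c.
  elim: c => [|s c IHc]; first by rewrite /= !ev_nil.
  by rewrite /= ev_cat ev_cons IHc.
have E t : ev f (flatten (map (@bd point) (flatten (map (step n t) (box_chain n))))) =
    ev f (map (map (upd n t.+1)) (box_chain n)) (+) ev f (map (map (upd n t)) (box_chain n)) (+)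
    ev f (flatten (map (step n t) (box_sides n ++ box_top n))).
  rewrite flat ev_cat -IH.
  elim: (box_chain n) {IH} => [|s c IHc]; first by rewrite /= !ev_nil.
  rewrite /= !map_cat !flatten_cat !ev_cat !ev_cons IHc /step bd_prism -/(step _ _).
  rewrite -(flat (bd s) t) /step.
  by case: (f _); case: (f _); case: (ev _ _); case: (ev _ _); case: (ev _ _);
    case: (ev _ _).
rewrite ev_cat.
suff H : ev f (flatten [seq bd i | i <- flatten
      [seq flatten [seq step n t i | i <- box_chain n] | t <- iota 0 N]]) =
   ev f (map (map (upd n N)) (box_chain n)) (+) ev f (map (map (upd n 0)) (box_chain n)) (+)
   ev f (flatten [seq flatten (map (step n t) (box_sides n ++ box_top n)) | t <- iota 0 N]).
  by rewrite H; case: (ev _ _); case: (ev _ _); case: (ev _ _).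
(* Telescoping, by induction on the number of slabs with the two chains held fixed. *)
move: (box_chain n) (box_sides n ++ box_top n) E => c d E {IH}.
elim: N => [|M IHM]; first by rewrite /= !ev_nil addbb.
rewrite -[M.+1]addn1 iotaD !map_cat !flatten_cat !map_cat !flatten_cat !ev_cat IHM //=.
rewrite !ev_nil !addbF add0n E addn1.
by case: (ev _ _); case: (ev _ _); case: (ev _ _); case: (ev _ _); case: (ev _ _).
Qed.

Definition inbox n (x : point) : Prop :=
  (forall j, j < n -> x j <= N) /\ (forall j, n <= j -> x j = 0).

Lemma inbox_upd n t x : t <= N -> inbox n x -> inbox n.+1 (upd n t x).
Proof.
move=> tN [xN x0]; split=> j; rewrite /upd; case: eqP => // jn jn'.
  by apply: xN; lia.
  by lia.
by apply: x0; lia.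
Qed.

Lemma all_prism (a b : pred point) p q s :
  (forall x, a x -> b (p x) && b (q x)) -> all a s -> all (all b) (prism p q s).
Proof.
move=> ab; elim: s => //= x s IH /andP[ax als].
have /andP[bp bq] := ab x ax; rewrite bp bq /= !all_map; apply/andP; split.
  by apply: sub_all als => y /ab /andP[].
by apply: sub_all (IH als) => r /=; rewrite bp.
Qed.

Lemma size_prism p q (s : seq point) :
  all (fun r => size r == (size s).+1) (prism p q s).
Proof.
by elim: s => //= x s IH; rewrite size_map eqxx /= all_map; apply: sub_all IH.
Qed.

Lemma box_chain_inbox n : all (all (fun x => `[< inbox n x >])) (box_chain n).
Proof.
elim: n => [|n IH] /=; first by rewrite !andbT; apply/asboolP; split.
rewrite all_flatten all_map; apply/allP => t; rewrite mem_iota => tN /=.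
rewrite all_flatten all_map; apply: sub_all IH => s; apply: all_prism => x.
by move=> /asboolP xb; apply/andP; split; apply/asboolP; apply: inbox_upd => //; lia.
Qed.

Definition unitcube (s : seq point) :=
  exists b : point, all (fun x => `[< forall j, b j <= x j <= (b j).+1 >]) s.

Lemma box_chain_cube n :
  all (fun s => (size s == n.+1) && `[< unitcube s >]) (box_chain n).
Proof.
elim: n => [|n IH] /=.
  rewrite andbT; apply/asboolP; exists (fun=> 0); rewrite /= andbT; exact/asboolP.
rewrite all_flatten all_map; apply/allP => t; rewrite mem_iota => tN /=.
rewrite all_flatten all_map; apply: sub_all IH => s /= /andP[/eqP sn /asboolP[b sb]].
have := size_prism (upd n t) (upd n t.+1) s; rewrite sn => H1.
have H2 : all (all (fun x => `[< forall j, upd n t b j <= x j <= (upd n t b j).+1 >]))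
    (step n t s).
  apply: all_prism sb => x /asboolP xb; apply/andP; split; apply/asboolP => j;
  by rewrite /upd; case: eqP => _ //; lia.
move: (introT andP (conj H1 H2)); rewrite -all_predI; apply: sub_all => r /andP[/eqP r1 r2].
by rewrite r1 eqxx; apply/asboolP; exists (upd n t b).
Qed.

(** All faces but the top x_{n-1} = N. The empty simplex, the augmented boundary of a point, starts
    the induction at n = 0. *)
Definition inface n (s : seq point) :=
  [\/ s = [::], exists2 j, j < n & all (fun x => x j == 0) s
    | exists2 j, j.+1 < n & all (fun x => x j == N) s].

Lemma box_top_inbox n : all (all (fun x => `[< inbox n x >])) (box_top n).
Proof.
case: n => //= n; rewrite all_map; apply: sub_all (box_chain_inbox n) => s /=.
rewrite all_map; apply: sub_all => x /asboolP xb; apply/asboolP.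
exact: inbox_upd.
Qed.

(** The prism over a simplex in a face stays in that face; the old top becomes a lateral face of the
    higher box, and the new floor has last coordinate 0. *)
Lemma box_sides_face n :
  all (fun s => all (fun x => `[< inbox n x >]) s && `[< inface n s >]) (box_sides n).
Proof.
elim: n => [|n IH].
  by rewrite /= andbT; apply/asboolP/Or31.
rewrite [box_sides _]/(_ ++ _) all_cat; apply/andP; split.
  rewrite all_map; apply: sub_all (box_chain_inbox n) => s sb /=; apply/andP; split.
    rewrite all_map; apply: sub_all sb => x /asboolP xb; apply/asboolP.
    exact: inbox_upd.
  apply/asboolP/Or32; exists n => //; rewrite all_map; apply/all_true => x /=.
  by rewrite /upd eqxx.
rewrite all_flatten all_map; apply/allP => t; rewrite mem_iota => tN /=.
have facestep s : inface n s \/ (exists2 j, j.+1 = n & all (fun x => x j == N) s) ->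
    all (fun r => `[< inface n.+1 r >]) (step n t s).
  have fstep j v : j < n -> all (fun x => x j == v) s ->
     all (all (fun x => x j == v)) (step n t s).
    by move=> jn; apply: all_prism => x xj; rewrite /upd (ltn_eqF jn) xj.
  move=> [[-> //|[j jn sj]|[j jn sj]]|[j jn sj]].
  - apply: sub_all (fstep _ _ jn sj) => r rj; apply/asboolP/Or32; exists j => //; lia.
  - apply: sub_all (fstep j _ _ sj); last by lia.
    by move=> r rj; apply/asboolP/Or33; exists j => //; lia.
  - apply: sub_all (fstep j _ _ sj); last by lia.
    by move=> r rj; apply/asboolP/Or33; exists j => //; lia.
have ibstep s : all (fun x => `[< inbox n x >]) s ->
    all (all (fun x => `[< inbox n.+1 x >])) (step n t s).
  by apply: all_prism => x /asboolP xb; apply/andP; split; apply/asboolP;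
    apply: inbox_upd => //; lia.
rewrite all_flatten all_map all_cat; apply/andP; split.
  apply: sub_all IH => s /= /andP[s1 /asboolP s2].
  rewrite all_predI ibstep //=; apply: facestep; by left.
have : all (fun s => all (fun x => `[< inbox n x >]) s &&
    `[< exists2 j, j.+1 = n & all (fun x => x j == N) s >]) (box_top n).
  case: (n) (box_top_inbox n) => // n' H; rewrite all_predI H /= all_map.
  apply/all_true => s /=; apply/asboolP; exists n' => //.
  by rewrite all_map; apply/all_true => x /=; rewrite /upd eqxx.
apply: sub_all => s /= /andP[s1 /asboolP s2].
rewrite all_predI ibstep //=; apply: facestep; by right.
Qed.

Definition full (L : point -> nat) n (s : seq point) :=
  perm_eq (map L s) (iota 0 n.+1).

Lemma ev_sub (a : pred (seq point)) f g c :
  all a c -> (forall s, a s -> f s = g s) -> ev f c = ev g c.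
Proof.
move=> ac fg; elim: c ac => [|s c IH] /=; first by rewrite !ev_nil.
by case/andP=> /fg E /IH E'; rewrite !ev_cons E E'.
Qed.

(** By [sperner_simplex] the parity is that of the boundary facets with labels 0, ..., n - 1. Such a
    facet lies on the top: a face x_j = 0 misses the label j, and a face x_j = N with j < n - 1 has
    labels at most j. The top satisfies the hypotheses in one dimension less. *)
Lemma sperner_box n (L : point -> nat) :
  (forall x, inbox n x -> L x <= n) ->
  (forall x j, inbox n x -> j < n -> x j = 0 -> L x <> j) ->
  (forall x j, inbox n x -> j < n -> x j = N -> L x <= j) ->
  ev (full L n) (box_chain n).
Proof.
elim: n L => [|n IH] L Ln L0 LN.
  rewrite /= ev_cons ev_nil addbF /full /=.
  have : L (fun=> 0) <= 0 by apply: Ln; split.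
  by rewrite leqn0 => /eqP ->.
have E : ev (full L n.+1) (box_chain n.+1) =
    ev (full L n) (flatten (map (@bd point) (box_chain n.+1))).
  rewrite ev_flatten; have := box_chain_inbox n.+1.
  elim: (box_chain n.+1) => [|s c IHc] /=; first by rewrite big_nil ev_nil.
  case/andP=> sb /IHc E; rewrite ev_cons big_cons E; congr addb.
  rewrite /full -sperner_simplex; last first.
    rewrite all_map; apply: sub_all sb => x /asboolP; exact: Ln.
  by rewrite bd_map count_oddE big_map.
rewrite E bd_box_chain.
have -> : ev (full L n) (box_sides n.+1) = false.
  have := box_sides_face n.+1; elim: (box_sides n.+1) => [|s c IHc]; first by rewrite ev_nil.
  rewrite ev_cons [all _ _]/(_ && _) => /andP[/andP[sb /asboolP sf]] /IHc ->.
  rewrite addbF; apply/negP => /perm_mem H.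
  have {}H j : j <= n -> exists i, [/\ i < size s, inbox n.+1 (nth (fun=> 0) s i) &
       L (nth (fun=> 0) s i) = j].
    move=> jn; have : j \in iota 0 n.+1 by rewrite mem_iota.
    rewrite -H => /(nthP 0)[i]; rewrite size_map => i1 i2; exists i.
    split=> //; last by rewrite -i2 (nth_map (fun=> 0)).
    by apply/asboolP; apply: (all_nthP _ sb).
  case: sf => [s0|[j jn sj]|[j jn sj]].
  - by have [i []] := H 0 isT; rewrite s0.
  - have [i [i1 i2]] := H j jn; apply: (L0 _ _ i2 jn).
    exact/eqP/(all_nthP _ sj).
  - have [i [i1 i2 i3]] := H n (leqnn _).
    have := LN _ j i2; rewrite i3 => /(_ _)H'; have : n <= j.
      by apply: H'; [lia|exact/eqP/(all_nthP _ sj)].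
    by lia.
rewrite [box_top _]/(map _ _) ev_map.
rewrite (@ev_sub predT _ (full (L \o upd n N) n)) //; last 2 first.
- exact: all_true.
- by move=> s _; rewrite /full /= -map_comp.
apply: IH => [x xb|x j xb jn xj|x j xb jn xj] /=.
- by apply: LN; [exact: inbox_upd| |rewrite /upd eqxx].
- by apply: L0; [exact: inbox_upd|lia|rewrite /upd; case: eqP => //; lia].
- by apply: LN; [exact: inbox_upd|lia|rewrite /upd; case: eqP => //; lia].
Qed.

Lemma ev_mem (a : pred (seq point)) f c : all a c -> ev f c ->
  exists s, a s /\ f s.
Proof.
elim: c => [|s c IH] /=; first by rewrite ev_nil.
case/andP=> as_ /IH {}IH; rewrite ev_cons; case fs : (f s) => //=.
by move=> _; exists s.
Qed.

(** The Sperner label [L x] is the first direction j in which the class of [x] reaches the face x_j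
    = N, or n if there is none. It depends on [U x] alone, so distinct Sperner labels come from
    distinct classes. *)
Theorem lebesgue_box n (T : Type) (U : point -> T) :
  (forall x y j, inbox n x -> inbox n y -> j < n -> x j = 0 -> y j = N ->
     U x <> U y) ->
  exists p : nat -> point,
    [/\ forall i, i <= n -> inbox n (p i),
        forall i k j, i <= n -> k <= n -> p i j <= (p k j).+1
      & forall i k, i <= n -> k <= n -> U (p i) = U (p k) -> i = k].
Proof.
move=> H.
pose tch x j := `[< exists2 y, inbox n y & y j = N /\ U y = U x >].
pose L x := find (tch x) (iota 0 n).
have Ln x : L x <= n by rewrite -[X in _ <= X](size_iota 0 n); exact: find_size.
have LN x j : inbox n x -> j < n -> x j = N -> L x <= j.
  move=> xb jn xj; rewrite leqNgt; apply/negP => /(before_find 0).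
  by rewrite nth_iota // => /asboolP; apply; exists x.
have L0 x j : inbox n x -> j < n -> x j = 0 -> L x <> j.
  move=> xb jn xj Lj.
  have hx : has (tch x) (iota 0 n) by rewrite has_find -/(L x) size_iota Lj.
  have := nth_find 0 hx; rewrite -/(L x) Lj nth_iota // => /asboolP[y yb [yj Uy]].
  exact: (H x y j).
have /(ev_mem (a := fun s => all (fun x => `[< inbox n x >]) s &&
     ((size s == n.+1) && `[< unitcube s >]))) [|s [/andP[sb /andP[/eqP ss /asboolP sc]]]] :=
   sperner_box (fun x _ => Ln x) L0 LN.
  by rewrite all_predI box_chain_inbox box_chain_cube.
move=> fs; exists (nth (fun=> 0) s).
split=> [i ni|i k j ni nk|i k ni nk Uik].
- by apply/asboolP; apply: (all_nthP _ sb); rewrite ss.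
- case: sc => b bs.
  have bnd l : l <= n -> b j <= nth (fun=> 0) s l j <= (b j).+1.
    move=> ln; have /asboolP : `[< forall j, b j <= nth (fun=> 0) s l j <= (b j).+1 >].
      by apply: (all_nthP _ bs); rewrite ss.
    exact.
  by have := bnd i ni; have := bnd k nk; lia.
- have us : uniq (map L s) by rewrite (perm_uniq fs) iota_uniq.
  apply/eqP; rewrite -(nth_uniq 0 _ _ us) ?size_map ?ss //.
  rewrite !(nth_map (fun=> 0)) ?ss //; apply/eqP.
  by rewrite /L; apply: eq_find => j; rewrite /tch Uik.
Qed.

(** The form for n colours, [V] naming the components of a colour: among n + 1 points with distinct
    pairs of colour and component, two share the colour by pigeonhole. *)
Corollary hex_box n (T : Type) (col : point -> nat) (V : point -> T) :
  (forall x, inbox n x -> col x < n) ->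
  (forall x y j, inbox n x -> inbox n y -> j < n -> x j = 0 -> y j = N ->
     col x = col y -> V x <> V y) ->
  exists x y : point, [/\ inbox n x, inbox n y,
     forall j, x j <= (y j).+1 /\ y j <= (x j).+1, col x = col y & V x <> V y].
Proof.
move=> coln H.
have [x y j xb yb jn x0 yN [cxy Vxy]|p [pb padj pinj]] :=
  @lebesgue_box n (nat * T) (fun x => (col x, V x)); first exact: (H x y j).
have cp (i : 'I_n.+1) : col (p i) < n by apply/coln/pb; rewrite -ltnS.
have /injectivePn[i [k ik cik]] : ~~ injectiveb (fun i : 'I_n.+1 => Ordinal (cp i)).
  by apply/injectiveP => /leq_card; rewrite !card_ord ltnn.
have {}cik : col (p i) = col (p k) by case: cik.
have [ni nk] : i <= n /\ k <= n by split; rewrite -ltnS.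
exists (p i), (p k); split=> //; try exact: pb; first by move=> j; split; exact: padj.
move=> Vik; move/eqP: ik; apply; apply: val_inj; apply: pinj => //.
by rewrite cik Vik.
Qed.

End box.

End covering_theorem.

(** * Families, pieces and the asymptotic dimension function *)

Lemma fset_le_sum (s : {fset nat}) i : i \in s -> (i <= \sum_(j <- enum_fset s) j)%N.
Proof. by move=> si; rewrite (big_rem i) //= leq_addr. Qed.

Section families_theory.
Context {R : realType} {X : metricType R}.
Implicit Types (U : set (set X)) (r l : R).

Lemma uniformly_boundedP U : uniformly_bounded U <->
  exists D : R, 0 <= D /\
    forall A x y, U A -> A x -> A y -> mdist x y <= D.
Proof.
split=> [Ub|[D [D0 UD]]]; last first.
  rewrite /uniformly_bounded; apply: (@le_lt_trans _ _ D%:E); last exact: ltry.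
  apply: ge_ereal_sup => _ [A UA <-]; apply: ge_ereal_sup => _ [[x y] [Ax Ay] <-].
  by rewrite lee_fin; exact: (UD A).
have H A x y : U A -> A x -> A y ->
    ((mdist x y)%:E <= ereal_sup [set diam A | A in U])%E.
  move=> UA Ax Ay; apply: (@le_trans _ _ (diam A)).
    by apply: ereal_sup_ubound; exists (x, y).
  by apply: ereal_sup_ubound; exists A.
move: Ub H; rewrite /uniformly_bounded; case: ereal_sup => [D| |]//= _ H.
- exists `|D|; split=> // A x y UA Ax Ay.
  by have := H A x y UA Ax Ay; rewrite lee_fin => /le_trans; apply; exact: ler_norm.
- by exists 0; split=> // A x y UA Ax Ay; have := H A x y UA Ax Ay.
Qed.

Lemma disjoint_family_eq r U A B x y : disjoint_family r U ->
  U A -> U B -> A x -> B y -> mdist x y <= r -> A = B.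
Proof.
move=> Ur UA UB Ax By xy; apply: contrapT => AB.
have := Ur _ _ UA UB AB; apply/negP; rewrite -leNgt.
apply: (@le_trans _ _ (mdist x y)%:E); last by rewrite lee_fin.
by apply: ereal_inf_lbound; exists (x, y).
Qed.

(** The margin 1 survives the infimum and yields the strict inequality. *)
Lemma disjoint_family_sep r U :
  (forall A B x y, U A -> U B -> A x -> B y -> A <> B -> r + 1 <= mdist x y) ->
  disjoint_family r U.
Proof.
move=> H A B UA UB AB; apply: (@lt_le_trans _ _ (r + 1)%:E).
  by rewrite lte_fin ltrDl.
apply: le_ereal_inf_tmp => _ [[x y] [Ax By] <-]; rewrite lee_fin.
exact: (H A B).
Qed.

(* [P] is covered by a uniformly bounded [r]-disjoint family, given by the
   fibres of a labelling of [P]. *)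
Definition piece (r : R) (P : set X) : Prop :=
  exists (I : Type) (f : X -> I) (D : R), forall x y, P x -> P y ->
    (f x = f y -> mdist x y <= D) /\ (f x <> f y -> r + 1 <= mdist x y).

Lemma piece_family r P : piece r P -> exists U : set (set X),
  [/\ uniformly_bounded U, disjoint_family r U & forall x, P x -> exists2 A, U A & A x].
Proof.
move=> [I [f [D H]]].
exists [set A | exists2 x, P x & A = [set y | P y /\ f y = f x]]; split.
- apply/uniformly_boundedP; exists `|D|; split=> // _ y z [x Px ->] [Py fy] [Pz fz].
  have [+ _] := H y z Py Pz; rewrite fy fz => /(_ erefl) /le_trans; apply.
  exact: ler_norm.
- apply: disjoint_family_sep => _ _ y z [a Pa ->] [b Pb ->] [Py fy] [Pz fz] ab.
  have [_] := H y z Py Pz; apply => fyz; apply: ab.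
  by rewrite -fy fyz fz.
- by move=> x Px; exists [set y | P y /\ f y = f x] => //; exists x.
Qed.

Lemma piece_le r r' P : r' <= r -> piece r P -> piece r' P.
Proof.
move=> rr [I [f [D H]]]; exists I, f, D => x y Px Py.
have [H1 H2] := H x y Px Py; split=> // /H2; apply: le_trans.
by rewrite lerD2r.
Qed.

Lemma Acoll_piece (s : {fset nat}) (P : nat -> set X) :
  (forall i, i \in s -> piece i%:R (P i)) ->
  (forall x, exists2 i, i \in s & P i x) -> ~ Acoll X s.
Proof.
move=> Ps Pc [_]; apply.
have H i : exists U : set (set X), i \in s ->
  [/\ uniformly_bounded U, disjoint_family i%:R U & forall x, P i x -> exists2 A, U A & A x].
  by have [/Ps/piece_family[U HU]|] := boolP (i \in s); [exists U|exists set0].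
have [U HU] := choice H; exists U; split=> [i /HU[]//|].
apply/seteqP; split=> // x _; have [i si Pix] := Pc x.
have [_ _ /(_ x Pix)[A UA Ax]] := HU i si.
by exists A => //; exists i.
Qed.

(** The common form of the upper bounds on the dimension: [a] takes [P0], the elements of [B] take
    the [P1 c], and at least [Q'] elements of [s] remain for the [P2 c]. *)
Lemma Acoll_pieces3 (s B : {fset nat}) (a Q Q' r1 r2 : nat) (P0 : set X)
    (P1 P2 : nat -> set X) :
  a \in s -> (B `<=` s)%fset -> a \notin B -> #|` B| = Q -> (Q + Q' < #|` s|)%N ->
  (forall i, i \in B -> (i <= r1)%N) -> (forall i, i \in s -> (i <= r2)%N) ->
  piece a%:R P0 -> (forall c, (c < Q)%N -> piece r1%:R (P1 c)) ->
  (forall c, (c < Q')%N -> piece r2%:R (P2 c)) ->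
  (forall x, [\/ P0 x, exists2 c, (c < Q)%N & P1 c x | exists2 c, (c < Q')%N & P2 c x]) ->
  ~ Acoll X s.
Proof.
move=> as_ Bs aB BQ sQ Br sr H0 H1 H2 H.
pose C := (s `\` (a |` B))%fset.
have CQ : (Q' <= #|` C|)%N.
  rewrite cardfsD (fsetIidPr _) ?fsubUset ?fsub1set ?as_ ?Bs// cardfsU1 aB BQ; lia.
pose P i := if i == a then P0 else
  if i \in B then P1 (index i (enum_fset B)) else
  [set x | (index i (enum_fset C) < Q')%N /\ P2 (index i (enum_fset C)) x].
apply: (@Acoll_piece s P) => [i is_|x].
  rewrite /P; have [->//|ia] := eqVneq i a.
  case: ifPn => iB.
    apply: (@piece_le r1%:R); first by rewrite ler_nat Br.
    by apply: H1; rewrite -BQ index_mem.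
  (* Elements of [C] beyond the first [Q'] get an empty piece. *)
  have [cQ|cQ] := ltnP (index i (enum_fset C)) Q'; last first.
    by exists unit, (fun=> tt), 0 => x y [].
  apply: (@piece_le r2%:R); first by rewrite ler_nat sr.
  have [I [f [D HD]]] := H2 _ cQ; exists I, f, D => x y [_ Px] [_ Py]; exact: HD.
case: (H x) => [P0x|[c cQ Px]|[c cQ Px]].
- by exists a => //; rewrite /P eqxx.
- have cB : nth 0%N (enum_fset B) c \in B by rewrite mem_nth// BQ.
  exists (nth 0%N (enum_fset B) c); first exact: (fsubsetP Bs).
  rewrite /P cB index_uniq ?BQ//; last exact: fset_uniq.
  by case: eqP cB => // ->; rewrite (negbTE aB).
- have cC : (c < size (enum_fset C))%N by exact: leq_trans CQ.
  have : nth 0%N (enum_fset C) c \in C by exact: mem_nth.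
  rewrite !inE negb_or => /andP[/andP[na nB] ns].
  exists (nth 0%N (enum_fset C) c) => //.
  by rewrite /P (negbTE na) (negbTE nB) /= index_uniq// fset_uniq.
Qed.

Lemma lebesgue_numberP U l l' x : (l%:E <= lebesgue_number U)%E ->
  l' < l -> exists2 A, U A & ball x l' `<=` A.
Proof.
move=> Ul ll.
have : (l'%:E < ereal_sup [set r%:E | r in
      [set r : R | (0 < r)%R /\ exists2 A, U A & ball x r `<=` A]])%E.
  apply: (@lt_le_trans _ _ l%:E); first by rewrite lte_fin.
  by apply: le_trans Ul _; apply: ereal_inf_lbound; exists x.
move=> /ereal_sup_gt[_ [r [r0 [A UA xA]] <-]]; rewrite lte_fin => lr.
exists A => //; apply: subset_trans xA => y; rewrite !ballEmdist /=.
by move=> /lt_trans; apply.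
Qed.

Lemma lebesgue_number_ge U l : 0 < l ->
  (forall x, exists2 A, U A & ball x l `<=` A) -> (l%:E <= lebesgue_number U)%E.
Proof.
move=> l0 H; apply: le_ereal_inf_tmp => _ [x _ <-].
by apply: ereal_sup_ubound; exists l => //; split.
Qed.

Definition overlap (n : nat) U : Prop :=
  exists p : nat -> set X, [/\ forall i, (i < n)%N -> U (p i),
    forall i j, (i < n)%N -> (j < n)%N -> p i = p j -> i = j
    & exists x, forall i, (i < n)%N -> p i x].

Lemma overlapP n U : overlap n U <-> exists F : set (set X),
    [/\ F `<=` U, F #= `I_n & \bigcap_(A in F) A !=set0].
Proof.
split=> [[p [pU pI [x px]]]|[F [FU Fn [x Fx]]]].
  exists (p @` `I_n); split.
  - by move=> _ [i ni <-]; exact: pU.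
  - by apply: inj_card_eq => i j; rewrite !inE; exact: pI.
  - by exists x => _ [i ni <-]; exact: px.
have /card_set_bijP[p [pF pI _]] : `I_n #= F by rewrite card_eq_sym.
exists p; split=> [i ni|i j ni nj|].
- by apply/FU/pF.
- by apply: pI; rewrite inE.
- by exists x => i ni; exact: (Fx _ (pF _ ni)).
Qed.

Lemma multiplicity_ge n U : overlap n U -> (n%:R%:E <= multiplicity U)%E.
Proof. by move=> /overlapP H; apply: ereal_sup_ubound; exists n. Qed.

Lemma multiplicity_le m U : (forall n, overlap n U -> (n <= m)%N) ->
  (multiplicity U <= m%:R%:E)%E.
Proof.
move=> H; apply: ge_ereal_sup => _ [n /overlapP/H nm <-].
by rewrite lee_fin ler_nat.
Qed.

Lemma multiplicity_cases U (x0 : X) :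
  multiplicity U = +oo%E \/ exists m : nat, multiplicity U = m%:R%:E /\ overlap m U.
Proof.
have [[M HM]|nM] := pselect (exists M, forall n, overlap n U -> (n <= M)%N).
  right; have o0 : exists n, `[< overlap n U >].
    by exists 0%N; apply/asboolP; exists (fun=> set0); split=> //; exists x0.
  case: (ex_maxnP (m := M) o0) => [n /asboolP/HM//|m /asboolP om mm].
  exists m; split=> //; apply/eqP; rewrite eq_le multiplicity_ge// andbT.
  by apply: multiplicity_le => n /asboolP/mm.
left; apply/eqyP => A A0; have [n nA] : exists n : nat, A <= n%:R.
  by exists (Num.bound A); rewrite ltW// archi_boundP// ltW.
have /existsNP[k /not_implyP[ok /negP kn]] := (forallNP _).2 nM n.
apply: le_trans (multiplicity_ge ok); rewrite lee_fin (le_trans nA)//.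
by rewrite ler_nat ltnW// ltnNge.
Qed.

Definition admissible l : set (set (set X)) := [set U : set (set X) |
     [/\ is_cover U, uniformly_bounded U & (l%:E <= lebesgue_number U)%E]].

Lemma ad_ge l n : (forall U, admissible l U -> overlap n.+1 U) ->
  (n%:R%:E <= ad X l)%E.
Proof.
move=> H; rewrite /ad leeBrDr// -EFinD natr1.
by apply: le_ereal_inf_tmp => _ [U /H oU <-]; exact: multiplicity_ge.
Qed.

Lemma ad_le l n U : admissible l U -> (forall k, overlap k U -> (k <= n.+1)%N) ->
  (ad X l <= n%:R%:E)%E.
Proof.
move=> Ul H; rewrite /ad leeBlDr// -EFinD natr1.
apply: le_trans (multiplicity_le H).
by apply: ereal_inf_lbound; exists U.
Qed.

(** The cover by singletons works, as open [l]-balls are points. *)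
Lemma ad_discrete l : 0 < l -> (forall x y : X, x <> y -> l <= mdist x y) ->
  (ad X l <= 0)%E.
Proof.
move=> l0 H; apply: (@ad_le l 0%N (range (fun x => [set x]))); last first.
  move=> k [p [pU pI [x px]]]; rewrite leqNgt; apply/negP => k1.
  have E i : (i < k)%N -> p i = [set x].
    by move=> ik; have [y _ yE] := pU i ik; have := px i ik; rewrite -yE => ->.
  have k0 := ltnW k1; have := pI 0%N 1%N k0 k1.
  by rewrite (E _ k0) (E _ k1) => /(_ erefl).
split.
- by apply/seteqP; split=> // x _; exists [set x].
- apply/uniformly_boundedP; exists 0; split=> // _ x y [z _ <-] -> ->.
  by rewrite mdistxx.
- apply: lebesgue_number_ge => // x; exists [set x]; first by exists x.
  move=> y; rewrite ballEmdist /= => xy; apply: contrapT => yx.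
  by have := H x y; rewrite leNgt xy => /(_ (fun e => yx (esym e))).
Qed.

(** Every class is enlarged to its open [l]-neighbourhood. Classes of one piece are more than
    [l + l] apart, so a point lies in at most one enlarged class for each of the n + 1 pieces. *)
Lemma pieces_admissible l n (P : nat -> set X) : 0 < l ->
  (forall c, (c <= n)%N -> piece (l + l) (P c)) ->
  (forall x, exists2 c, (c <= n)%N & P c x) ->
  exists2 U, admissible l U & forall k, overlap k U -> (k <= n.+1)%N.
Proof.
move=> l0 Pp Pc.
have H c : exists If : {I : Type & ((X -> I) * R)%type},
    let f := (projT2 If).1 in let D := (projT2 If).2 in
    (c <= n)%N -> forall x y, P c x -> P c y ->
    (f x = f y -> mdist x y <= D) /\ (f x <> f y -> l + l + 1 <= mdist x y).
  have [/Pp[I [f [D HD]]]|] := boolP (c <= n)%N; first by exists (existT _ I (f, D)).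
  by exists (existT (fun I : Type => ((X -> I) * R)%type) unit (fun=> tt, 0)).
have {H}[If H] := choice H.
pose f c := (projT2 (If c)).1; pose D c := (projT2 (If c)).2.
pose E c x0 := [set y | exists x, [/\ P c x, f c x = f c x0 & mdist x y < l]].
exists [set A | exists c x0, [/\ (c <= n)%N, P c x0 & A = E c x0]].
  split.
  - apply/seteqP; split=> // x _; have [c cn Pcx] := Pc x.
    by exists (E c x); [exists c, x|exists x; rewrite mdistxx].
  - apply/uniformly_boundedP; exists (\sum_(c < n.+1) `|D c| + (l + l)); split.
      by rewrite addr_ge0 ?sumr_ge0// addr_ge0// ltW.
    move=> _ x y [c [x0 [cn Px0 ->]]] [x' [Px' fx' xl]] [y' [Py' fy' yl]].
    have [+ _] := H c cn x' y' Px' Py'; rewrite -/(f c) -/(D c) fx' fy' => /(_ erefl) xy.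
    have : D c <= \sum_(c < n.+1) `|D c|.
      rewrite (bigD1 (Ordinal (cn : (c < n.+1)%N)))//=.
      apply: le_trans (ler_norm _) _; rewrite lerDl; exact: sumr_ge0.
    have := metric_triangle x x' y; have := metric_triangle x' y' y.
    rewrite (metric_sym x x'); lra.
  - apply: lebesgue_number_ge => // x; have [c cn Pcx] := Pc x.
    exists (E c x); first by exists c, x.
    by move=> y; rewrite ballEmdist /= => xy; exists x.
move=> k [p [pU pI [x px]]].
have cP (i : 'I_k) : exists c : 'I_n.+1, exists x0, P c x0 /\ p i = E c x0.
  have [c [x0 [cn Px0 pE]]] := pU i (ltn_ord i).
  by exists (Ordinal (cn : (c < n.+1)%N)), x0.
have [c cE] := choice cP.
have /leq_card : injective c; last by rewrite !card_ord.
move=> i j cij; apply/val_inj/(pI _ _ (ltn_ord i) (ltn_ord j)).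
have [xi [Pxi pi]] := cE i; have [xj [Pxj pj]] := cE j.
have := px _ (ltn_ord i); have := px _ (ltn_ord j); rewrite pi pj -cij.
move=> [yj [Pyj fyj yjl]] [yi [Pyi fyi yil]].
have [_] := H (c i) (ltn_ord (c i)) yi yj Pyi Pyj; rewrite -/(f (c i)) => Hij.
have fij : f (c i) yi = f (c i) yj.
  apply: contrapT => /Hij; have := metric_triangle yi x yj.
  by rewrite (metric_sym x yj); lra.
have fx : f (c i) xi = f (c i) xj by rewrite -fyi -fyj.
by rewrite /E fx.
Qed.

(** Multiplicities are naturals or +oo, so one cover of finite multiplicity makes the infimum a
    minimum. The point [x0] forces it to be at least 1, so subtracting 1 stays in the naturals. *)
Lemma ad_nat (x0 : X) l U n : admissible l U ->
  (forall k, overlap k U -> (k <= n)%N) ->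
  exists m : nat, [/\ ad X l = m%:R%:E, (ad X l + 1 = m.+1%:R%:E)%E & (m < n)%N].
Proof.
move=> Ul Un.
have [Uoo|[k [mk ok]]] := multiplicity_cases U x0.
  by have := multiplicity_le Un; rewrite Uoo.
pose Q := fun m => `[< exists2 V, admissible l V & multiplicity V = m%:R%:E >].
have exQ : exists m, Q m by exists k; apply/asboolP; exists U.
case: (ex_minnP exQ) => m /asboolP[V Vl Vm] mmin.
have inf : ereal_inf [set multiplicity U | U in admissible l] = m%:R%:E.
  apply/eqP; rewrite eq_le; apply/andP; split.
    by apply: ereal_inf_lbound; exists V.
  apply: le_ereal_inf_tmp => _ [W Wl <-].
  have [->|[j [Wj _]]] := multiplicity_cases W x0; first exact: leey.
  by rewrite Wj lee_fin ler_nat; apply: mmin; apply/asboolP; exists W.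
have m0 : (0 < m)%N.
  rewrite lt0n; apply/eqP => m0; have [+ _ _] := Vl.
  move=> /seteqP[_ /(_ x0 I)[A VA Ax]].
  have : overlap 1 V.
    by exists (fun=> A); split=> // [[|i] [|j]//|]; exists x0.
  by move=> /multiplicity_ge; rewrite Vm m0 lee_fin ler_nat.
exists m.-1; rewrite /ad -/(admissible l) inf; split.
- by rewrite -EFinB -[in LHS](prednK m0) -natr1 addrK.
- by rewrite subeK// prednK.
- by rewrite prednK// (leq_trans (mmin k _))//; [apply/asboolP; exists U|exact: Un].
Qed.

End families_theory.

Definition zmetric (R : realType) (X : metricType R) :=
  forall x y : X, exists n : nat, mdist x y = n%:R.

(** With integral distances the open balls of all radii in ]i, i + 1] coincide. *)
Lemma ad_zmetric (R : realType) (X : metricType R) (i : nat) (r : R) :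
  zmetric X -> i%:R < r -> r <= i.+1%:R -> ad X r = ad X i.+1%:R.
Proof.
move=> ZX ir ri; suff E : admissible r = admissible (i.+1%:R : R) :> set (set (set X)).
  by rewrite /ad -/(admissible _) E.
apply/seteqP; split=> U [Uc Ub Ul]; split=> //; last first.
  by apply: le_trans Ul; rewrite lee_fin.
apply: lebesgue_number_ge => // x.
(* Lebesgue number at least [r] yields balls of radii below [r] only; the midpoint still exceeds
   [i]. *)
have /andP[il lr] : i%:R < (i%:R + r) / 2 < r by rewrite midf_lt// midf_lt.
have [A UA xA] := lebesgue_numberP x Ul lr.
exists A => // y; rewrite ballEmdist /= => xy; apply: xA; rewrite ballEmdist /=.
apply: le_lt_trans il; have [n nE] := ZX x y.
by move: xy; rewrite nE ltr_nat ltnS ler_nat.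
Qed.

(** * Lattice points and integral distances in the max metric *)

Section finseq_theory.
Context {R : realType}.
Implicit Types x y : finseq R.

Lemma finseq_dist_ge x y m : `|x m - y m| <= mdist x y.
Proof.
rewrite finseq_mdistE.
have [mI|] := boolP (m \in (finsupp x `|` finsupp y)%fset).
  exact: le_bigmax_seq mI _.
by rewrite in_fsetU negb_or => /andP[/fsfun_dflt -> /fsfun_dflt ->];
  rewrite subrr normr0; exact: bigmax_ge_id.
Qed.

Lemma finseq_dist_le x y c : 0 <= c -> (forall m, `|x m - y m| <= c) -> mdist x y <= c.
Proof. by move=> c0 H; rewrite finseq_mdistE; apply: bigmax_le. Qed.

Lemma finseq_dist_nat x y : (forall m, exists n : nat, `|x m - y m| = n%:R) ->
  exists n : nat, mdist x y = n%:R.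
Proof.
move=> H; rewrite finseq_mdistE.
elim/big_ind : _ => [|_ _ [a ->] [b ->]|m _]; first by exists 0%N.
  by exists (maxn a b); rewrite natr_max.
exact: H.
Qed.

Definition lattice (n : nat) (c : R) (u : nat -> nat) : finseq R :=
  [fsfun m in [fset m in iota 0 n]%fset => c * (u m)%:R].

Lemma latticeE n c u m : lattice n c u m = if (m < n)%N then c * (u m)%:R else 0.
Proof. by rewrite fsfunE !inE /= mem_iota. Qed.

Lemma lattice_dist_le n c u v d : 0 <= c ->
  (forall m, (m < n)%N -> u m <= v m + d /\ v m <= u m + d)%N ->
  mdist (lattice n c u) (lattice n c v) <= c * d%:R.
Proof.
move=> c0 H; apply: finseq_dist_le => [|m]; first by rewrite mulr_ge0.
rewrite !latticeE; case: ltnP => mn; last by rewrite subrr normr0 mulr_ge0.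
rewrite -mulrBr normrM ger0_norm// ler_wpM2l//.
have [H1 H2] := H m mn; rewrite ler_norml; move: H1 H2.
by rewrite -(ler_nat R) -(ler_nat R (v m)) !natrD; lra.
Qed.

Lemma lattice_dist_ge n c u v m : 0 <= c -> (m < n)%N ->
  c * ((v m)%:R - (u m)%:R) <= mdist (lattice n c u) (lattice n c v).
Proof.
move=> c0 mn; apply: le_trans (finseq_dist_ge _ _ m).
rewrite !latticeE mn -mulrBr normrM ger0_norm// ler_wpM2l//.
by rewrite distrC ler_norm.
Qed.

Lemma pow2Z_nat k a : 2 ^+ k * a%:R \in @pow2Z R k.
Proof. by rewrite inE /= mulrAC divff ?mul1r ?natr_int// expf_neq0// pnatr_eq0. Qed.

Lemma lattice_pow2Zn k n u : pow2Zn k n (lattice n (2 ^+ k) u).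
Proof.
split=> m mn; rewrite latticeE; first by rewrite ltnNge mn.
by rewrite mn pow2Z_nat.
Qed.

Lemma pow2Z_dist k (a b : R) : a \in pow2Z k -> b \in pow2Z k ->
  exists n : nat, `|a - b| = (2 ^ k * n)%:R.
Proof.
rewrite !inE => ak bk.
have : (a - b) / 2 ^+ k \is a Num.int by rewrite mulrBl rpredB.
move=> /intrP[z zE]; exists `|z|%N.
have p0 : (2 ^+ k : R) != 0 by rewrite expf_neq0 ?pnatr_eq0.
rewrite -[a - b](mulfVK p0) zE normrM natrM natrX mulrC ger0_norm ?exprn_ge0//.
by rewrite natr_absz intr_norm.
Qed.

Lemma pow2Zn_coord k n x m : pow2Zn k n x -> x m \in pow2Z k.
Proof.
move=> [x0 xk]; have [mn|mn] := ltnP m n; first exact: xk.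
by rewrite x0// inE mul0r int_num0.
Qed.

Lemma pow2Zn_dist k n k' n' x y : pow2Zn k n x -> pow2Zn k' n' y ->
  exists d : nat, mdist x y = d%:R.
Proof.
have Zint (z : R) i : z \in pow2Z i -> z \in pow2Z 0.
  rewrite !inE divr1 => zi; rewrite -[z](@mulfVK _ (2 ^+ i)) ?expf_neq0 ?pnatr_eq0//.
  by rewrite rpredM// rpredX// natr_int.
move=> xk yk; apply: finseq_dist_nat => m.
have [d ->] := pow2Z_dist (Zint _ _ (pow2Zn_coord m xk)) (Zint _ _ (pow2Zn_coord m yk)).
by exists (2 ^ 0 * d)%N.
Qed.

Lemma pow2Zn_sep k n n' x y : pow2Zn k n x -> pow2Zn k n' y -> x <> y ->
  2 ^+ k <= mdist x y.
Proof.
move=> xk yk xy; have [m xym] : exists m, x m <> y m.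
  by apply: contrapT => /forallNP H; apply: xy; apply/fsfunP => m; apply: contrapT; exact: H.
apply: le_trans (finseq_dist_ge _ _ m).
have [d dE] := pow2Z_dist (pow2Zn_coord m xk) (pow2Zn_coord m yk).
rewrite dE; case: d dE => [|d] dE.
  by move: dE; rewrite muln0 => /eqP; rewrite normr_eq0 subr_eq0 => /eqP.
by rewrite natrM natrX ler_peMr ?exprn_ge0// ler1n.
Qed.

End finseq_theory.

(* The property of a map from N^n to [X] that transports the covering theorem
   from the lattice to [X]. *)
Definition gridlike (R : realType) (X : metricType R) (n : nat) (c : R)
    (e : (nat -> nat) -> X) : Prop :=
  (forall u v, (forall j, u j <= (v j).+1 /\ v j <= (u j).+1)%N ->
     mdist (e u) (e v) <= c) /\
  (forall u v j, (j < n)%N -> (v j)%:R - (u j)%:R <= mdist (e u) (e v)).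

Section gridlike_theory.
Context {R : realType} {X : metricType R}.
Variables (n : nat) (c : R) (e : (nat -> nat) -> X).
Hypothesis ge : gridlike n c e.

(** Label [u] by a member of the cover containing a ball around [e u] of radius between [c] and [r],
    hence the images of all neighbours of [u]. On a box longer than the diameter bound no label
    joins opposite faces, and the n + 1 members found all contain [e (p 0%N)]. *)
Lemma ad_gridlike (r : R) : c < r -> (n%:R%:E <= ad X r)%E.
Proof.
move=> cr; apply: ad_ge => U [Uc Ub Ul].
have [D [D0 UD]] := (uniformly_boundedP _).1 Ub.
have /andP[cl lr] : c < (c + r) / 2 < r by rewrite midf_lt// midf_lt.
have H u : exists A, U A /\ ball (e u) ((c + r) / 2) `<=` A.
  by have [A UA HA] := lebesgue_numberP (e u) Ul lr; exists A.
have [A HA] := choice H.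
have c0 : 0 <= c.
  have [/(_ (fun=> 0%N) (fun=> 0%N)) + _] := ge; rewrite mdistxx; exact.
have eA u v : (forall j, u j <= (v j).+1 /\ v j <= (u j).+1)%N -> A u (e v).
  move=> uv; have [_] := HA u; apply; rewrite ballEmdist /=.
  by apply: le_lt_trans cl; apply: ge.1.
have [u v j ub vb jn uj vj Auv|p [pb padj pinj]] := @lebesgue_box (Num.bound D) n _ A.
  have [_ /(_ u v j jn)] := ge; rewrite uj vj subr0; apply/negP; rewrite -ltNge.
  apply: le_lt_trans (archi_boundP D0); apply: (UD (A u)); first by have [] := HA u.
    by apply: eA => k; lia.
  by rewrite Auv; apply: eA => k; lia.
exists (A \o p); split=> [i _|i j ni nj|].
- by have [] := HA (p i).
- by move=> /= pij; apply: pinj.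
- by exists (e (p 0%N)) => i ni; apply: eA => j; split; exact: padj.
Qed.

(** Colour [u] by the position in [s] of a family covering [e u]. The neighbours given by [hex_box]
    lie in different sets of one family at distance at most [c], against disjointness. *)
Lemma Acoll_gridlike (s : {fset nat}) : FinN s -> (#|` s| <= n)%N ->
  (forall i, i \in s -> c <= i%:R) -> Acoll X s.
Proof.
move=> sF sn sc; split=> // -[U [HU Uc]].
have Ub i : exists D : R, i \in s -> 0 <= D /\
    forall A x y, U i A -> A x -> A y -> mdist x y <= D.
  have [is_|] := boolP (i \in s); last by exists 0.
  by have [/uniformly_boundedP[D HD] _] := HU i is_; exists D.
have [D HD] := choice Ub.
have H u : exists iA : nat * set X, [/\ iA.1 \in s, U iA.1 iA.2 & iA.2 (e u)].
  have /seteqP[_ /(_ (e u) I)[A [i /= si UA] Ax]] := Uc.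
  by exists (i, A).
have [iA HiA] := choice H.
pose N := Num.bound (\sum_(i <- enum_fset s) `|D i|).
have DN i : i \in s -> D i < N%:R.
  move=> si; apply: le_lt_trans (archi_boundP _); last exact: sumr_ge0.
  apply: le_trans (ler_norm _) _; rewrite (big_rem i)//= lerDl; exact: sumr_ge0.
pose col u := index (iA u).1 (enum_fset s).
have colE u v : col u = col v -> (iA u).1 = (iA v).1.
  have [su _ _] := HiA u; have [sv _ _] := HiA v.
  by move=> /(congr1 (nth 0%N (enum_fset s))); rewrite !nth_index.
have [u|u v j ub vb jn uj vj cuv|u [v [ub vb uv cuv]]] :=
    @hex_box N n _ col (fun u => (iA u).2).
- by move=> _; apply: leq_trans sn; rewrite index_mem; have [] := HiA u.
- move=> Auv; have [su Uu eu] := HiA u; have [_ _ ev] := HiA v.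
  have [_ HDu] := HD _ su; have := DN _ su; apply/negP; rewrite -leNgt.
  apply: le_trans (HDu _ _ _ Uu eu _); last by rewrite Auv; exact: ev.
  by have [_ /(_ u v j jn)] := ge; rewrite uj vj subr0.
- apply; have [su Uu eu] := HiA u; have [_ Uv ev] := HiA v.
  have [_ dj] := HU _ su.
  apply: (disjoint_family_eq dj Uu _ eu ev); first by rewrite (colE _ _ cuv).
  exact: le_trans (ge.1 _ _ uv) (sc _ su).
Qed.

End gridlike_theory.

(** * Transfinite ordinals *)

Fixpoint tonat (n : nat) : tord :=
  if n is n'.+1 then tosup (fun _ : unit => tonat n') else tozero.

Definition toomega : tord := tosup tonat.

Lemma tolt_le_trans a b c : tolt a b -> tole b c -> tolt a c.
Proof.
case: b c => [B g] [C h] /= [j agj] /(_ j)[k gh]; exists k; exact: tole_trans gh.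
Qed.

Lemma tole_zero a : tole tozero a.
Proof. by case: a => A f []. Qed.

Lemma tolt_tonat b n : tolt b (tonat n) -> exists2 m, n = m.+1 & tole b (tonat m).
Proof. by case: n => [[[]]|n [_ bn]]; exists n. Qed.

Lemma tonat_lt_add n k : tolt (tonat n) (toadd toomega (tonat k)).
Proof. by case: k => [|k]; exists (inl n); exact: tole_refl. Qed.

Lemma tolt_le a b : tolt a b -> tole a b.
Proof.
elim: a b => A f IH [B g] /= [j fj] i; exists j; apply: IH.
case: (g j) fj => C h /= /(_ i) [k fk]; by exists k.
Qed.

Lemma tolt_omega_add b k : tolt b (toadd toomega (tonat k.+1)) ->
  tole b (toadd toomega (tonat k)).
Proof.
move=> /= [[n bn|_ //]]; apply: tole_trans bn _; exact/tolt_le/tonat_lt_add.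
Qed.

Lemma toomega_add0 : tole (toadd toomega tozero) toomega.
Proof. by move=> [n|[]]; exists n; exact: tole_refl. Qed.

Lemma tolt_omega2 b : tolt b (toadd toomega toomega) ->
  exists k, tole b (toadd toomega (tonat k)).
Proof.
move=> [[n bn|k bk]]; last by exists k.
by exists 0%N; apply: tole_trans bn _; apply/tolt_le/tonat_lt_add.
Qed.

Lemma link0 i : link set0 i = set0.
Proof. by apply/seteqP; split=> // s []. Qed.

(** The empty collection is treated apart: [Ord_le_zero] bounds it by 0 only, and larger bounds come
    from its links, which are empty. *)
Lemma Ord_le_mono M a b : Ord_le M a -> tole a b -> Ord_le M b.
Proof.
have Ord0 c : Ord_le set0 c.
  case: c => C h; have [[j _]|nC] := pselect (exists j : C, True).
    have c0 : tolt tozero (tosup h) by exists j; exact: tole_zero.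
    apply: (Ord_le_pos c0) => i i0; exists tozero; first by exists j; exact: tole_zero.
    by rewrite link0; apply: Ord_le_zero => //; split; exact: tole_refl.
  by apply: Ord_le_zero => //; split=> [j|[]]; case: nC; exists j.
case=> [{}M {}a _ -> _|{}M {}a a0 H ab]; first exact: Ord0.
apply: Ord_le_pos; first exact: tolt_le_trans ab.
by move=> i /H[c ca Mc]; exists c => //; exact: tolt_le_trans ab.
Qed.

Lemma link1P M i s : FinN s -> M s -> i \in s ->
  s = [fset i]%fset \/ link M [fset i]%fset (s `\ i)%fset.
Proof.
move=> sF Ms si; have [s0|s0] := eqVneq (s `\ i)%fset fset0.
  by left; rewrite -(fsetD1K si) s0 fsetU0.
right; split; first by split; [exact/eqP|move=> j /fsetD1P[_] /sF.2].
  by rewrite fsetUC fsetD1K.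
by apply/fsetP => j; rewrite !inE; case: eqP => //=; rewrite ?andbF.
Qed.

Lemma link1_card M i s : link M [fset i]%fset s ->
  i \notin s /\ #|` (s `|` [fset i])%fset| = #|` s|.+1.
Proof.
move=> [_ _ si]; have ns : i \notin s.
  by apply/negP => is_; move/fsetP/(_ i): si; rewrite !inE is_ eqxx.
by split=> //; rewrite fsetUC cardfsU1 ns.
Qed.

Lemma Ord_le_tonat M n : M `<=` FinN -> (forall s, M s -> (#|` s| <= n)%N) ->
  Ord_le M (tonat n).
Proof.
elim: n M => [|n IH] M MF Mn.
  apply: Ord_le_zero; first by split; exact: tole_refl.
  apply/seteqP; split=> // s Ms; have := Mn s Ms.
  by rewrite leqn0 cardfs_eq0 => /eqP; case: (MF s Ms).
apply: Ord_le_pos => [|i i0]; first by exists tt; exact: tole_zero.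
exists (tonat n); first by exists tt; exact: tole_refl.
apply: IH => [s []//|s sM]; have [_] := link1_card sM.
by case: sM => _ /Mn + _ => + E; rewrite E ltnS.
Qed.

Lemma Ord_le_card M a n s : Ord_le M a -> tole a (tonat n) -> FinN s -> M s ->
  (#|` s| <= n)%N.
Proof.
elim: n M a s => [|n IH] M a s Ma an sF Ms.
  case: Ma an Ms => [{}M {}a _ -> //|{}M {}a a0 _ /tole_trans a0'].
  by have [[]] := tolt_le_trans a0 (a0' _ (tole_refl _)).
case: Ma an Ms => [{}M {}a _ -> //|{}M {}a a0 H an Ms].
have [i si] : exists i, i \in s by apply/fset0Pn/eqP; case: sF.
have [b ba Mb] := H i (sF.2 i si).
have [m [<-] bm] := tolt_tonat (tolt_le_trans ba an).
have [->|lM] := link1P sF Ms si; first by rewrite cardfs1.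
by rewrite (cardfsD1 i) si ltnS; apply: (IH _ _ _ Mb bm _ lM); case: lM.
Qed.

(** The elements of [B] are removed one at a time by links; each of the first k lowers the bound by
    one, and after the last only sets of bounded size remain, so the bound is finite. *)
Lemma Ord_le_omega_add M k : M `<=` FinN ->
  (forall B : {fset nat}, #|` B| = k.+1 -> (forall i, i \in B -> (0 < i)%N) ->
     exists m, forall s, M s -> (B `<=` s)%fset -> (#|` s| <= m)%N) ->
  Ord_le M (toadd toomega (tonat k)).
Proof.
elim: k M => [|k IH] M MF H.
  apply: Ord_le_pos => [|i i0]; first by exists (inl 0%N); exact: tole_refl.
  have [|j|m Hm] := H [fset i]%fset; [by rewrite cardfs1|by rewrite inE => /eqP ->|].
  exists (tonat m); first exact: tonat_lt_add.
  apply: Ord_le_tonat => [s []//|s sM]; have [_ E] := link1_card sM.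
  apply: ltnW; rewrite -E; apply: Hm; first by case: sM.
  by rewrite fsubsetUr.
apply: Ord_le_pos => [|i i0]; first by exists (inl 0%N); exact: tole_refl.
exists (toadd toomega (tonat k)); first by exists (inr tt); exact: tole_refl.
apply: IH => [s []//|B Bk B0].
(* Sets in the link at [i] avoid [i], so none of them contains [B] in the first case. *)
have [iB|iB] := boolP (i \in B).
  exists 0%N => s /link1_card[/negP ns _] /fsubsetP /(_ i iB) //.
have [|j|m Hm] := H (i |` B)%fset; first by rewrite cardfsU1 iB Bk.
  by rewrite !inE => /orP[/eqP ->//|/B0].
exists m => s sM Bs; have [_ E] := link1_card sM.
apply: ltnW; rewrite -E; apply: Hm; first by case: sM.
by rewrite fsubUset fsubsetUr fsubsetU// Bs.
Qed.

(** The converse of [Ord_le_omega_add], by the same descent through links at elements of [B]. *)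
Lemma Ord_le_omega_add_card M a k (B : {fset nat}) :
  Ord_le M a -> tole a (toadd toomega (tonat k)) ->
  #|` B| = k.+1 -> (forall i, i \in B -> (0 < i)%N) ->
  exists m, forall s, FinN s -> M s -> (B `<=` s)%fset -> (#|` s| <= m)%N.
Proof.
elim: k M a B => [|k IH] M a B Ma aw Bk B0.
  case: Ma aw => [{}M {}a _ -> _|{}M {}a a0 H aw]; first by exists 0%N.
  have [i iB] : exists i, i \in B by apply/fset0Pn; rewrite -cardfs_gt0 Bk.
  have [b ba Mb] := H i (B0 i iB).
  have [[m bm|[]]] := tolt_le_trans ba aw.
  exists m.+1 => s sF Ms /fsubsetP/(_ i iB) si.
  have [->|lM] := link1P sF Ms si; first by rewrite cardfs1.
  rewrite (cardfsD1 i) si ltnS; apply: (Ord_le_card Mb bm _ lM); by case: lM.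
case: Ma aw => [{}M {}a _ -> _|{}M {}a a0 H aw]; first by exists 0%N.
have [i iB] : exists i, i \in B by apply/fset0Pn; rewrite -cardfs_gt0 Bk.
have [b ba Mb] := H i (B0 i iB).
have bk := tolt_omega_add (tolt_le_trans ba aw).
have [|j /fsetD1P[_ /B0//]|m Hm] := IH _ _ (B `\ i)%fset Mb bk.
  by move: Bk; rewrite (cardfsD1 i) iB => -[].
exists m.+1 => s sF Ms Bs; have si := fsubsetP Bs i iB.
have [->|lM] := link1P sF Ms si; first by rewrite cardfs1.
rewrite (cardfsD1 i) si ltnS; apply: (Hm _ _ lM); first by case: lM.
exact: fsetSD.
Qed.

(** * Criteria for the dimensions omega and 2 omega *)

Section trasdim_values.
Context {R : realType} {X : metricType R}.

Lemma Acoll_FinN : Acoll X `<=` FinN. Proof. by move=> s []. Qed.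

Lemma trasdim_omega :
  (forall a, (0 < a)%N -> exists m, forall s, Acoll X s -> a \in s -> (#|` s| <= m)%N) ->
  (forall n, exists2 s, Acoll X s & (n < #|` s|)%N) ->
  trasdim_eq X toomega.
Proof.
move=> up low; split.
  apply: Ord_le_mono toomega_add0; apply: (@Ord_le_omega_add _ 0%N) Acoll_FinN _.
  move=> B /eqP/cardfs1P[a ->] B0.
  have [|m Hm] := up a; first by apply: B0; rewrite inE.
  by exists m => s Xs; rewrite fsub1set; exact: Hm.
move=> [b [n bn] /Ord_le_card Xb]; have [s Xs] := low n.
by rewrite ltnNge; apply/negP; rewrite negbK; exact: (Xb _ _ bn (Acoll_FinN Xs)).
Qed.

(** Every ordinal below omega + omega is at most some omega + k. So the link at [a] has to come down
    to omega + k with k depending on [a], and a smaller value of Ord is refuted by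
    [Ord_le_omega_add_card]. *)
Lemma trasdim_omega2 :
  (forall a, (0 < a)%N -> exists k, forall B : {fset nat}, #|` B| = k.+1 ->
     a \notin B -> (forall i, i \in B -> (0 < i)%N) ->
     exists m, forall s, Acoll X s -> a \in s -> (B `<=` s)%fset -> (#|` s| <= m)%N) ->
  (forall k, exists B : {fset nat}, [/\ #|` B| = k.+1, forall i, i \in B -> (0 < i)%N
     & forall m, exists s, [/\ Acoll X s, (B `<=` s)%fset & (m < #|` s|)%N]]) ->
  trasdim_eq X (toadd toomega toomega).
Proof.
move=> up low; split.
  apply: Ord_le_pos => [|a a0]; first by exists (inl 0%N); exact: tole_refl.
  have [k Hk] := up a a0; exists (toadd toomega (tonat k)).
    by exists (inr k); exact: tole_refl.
  apply: Ord_le_omega_add => [s []//|B Bk B0].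
  have [aB|aB] := boolP (a \in B).
    by exists 0%N => s /link1_card[/negP ns _] /fsubsetP /(_ a aB).
  have [m Hm] := Hk B Bk aB B0; exists m => s sM Bs; have [_ E] := link1_card sM.
  apply: ltnW; rewrite -E; apply: Hm; first by case: sM.
    by rewrite !inE eqxx orbT.
  exact: fsubsetU (introT orP (or_introl Bs)).
move=> [b /tolt_omega2[k bk] Xb].
have [B [Bk B0 HB]] := low k.
have [m Hm] := Ord_le_omega_add_card Xb bk Bk B0.
have [s [Xs Bs]] := HB m.
by rewrite ltnNge => /negP; apply; apply: Hm => //; exact: Acoll_FinN.
Qed.

End trasdim_values.

(** * Slab coverings *)

Section slabs.
Context {R : realType}.
Implicit Types (L v : R) (x y : finseq R).

Definition cell L v : int := Num.floor (v / L).
Definition colour L (Q : nat) v : nat := `|(cell L v %% Q)%Z|%N.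
Definition avoids L Q n c x : Prop := forall m, (m < n)%N -> colour L Q (x m) <> c.
(** Deleting the cells of colour [c] leaves runs of Q - 1 consecutive cells; this indexes the run
    containing [v]. *)
Definition slab L (Q c : nat) v : int := ((cell L v - c%:Z) %/ Q)%Z.
Definition slabs L Q n c x (m : nat) : int :=
  if (m < n)%N then slab L Q c (x m) else 0.

(** Numbers in one run differ by at most its length; between different runs lies a whole deleted
    cell, of length [L]. *)
Lemma slab_sep L Q c v v' : 0 < L -> (c < Q)%N ->
  colour L Q v <> c -> colour L Q v' <> c ->
  (slab L Q c v = slab L Q c v' -> `|v - v'| <= Q%:R * L) /\
  (slab L Q c v <> slab L Q c v' -> L <= `|v - v'|).
Proof.
move=> L0 cQ; rewrite /colour /slab.
have Q0 : (0 < Q%:Z)%R by rewrite ltz_nat; lia.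
(* The remainder of w - c mod Q vanishes only for cells of colour [c]. *)
have key w : `|(w %% Q)%Z|%N <> c -> exists q s : int,
    [/\ ((w - c%:Z) %/ Q)%Z = q, w - c%:Z = q * Q%:Z + s, 1 <= s & s <= Q%:Z - 1].
  move=> wc; exists ((w - c%:Z) %/ Q)%Z, ((w - c%:Z) %% Q)%Z.
  have := divz_eq (w - c%:Z) Q; have := modz_ge0 (w - c%:Z) (lt0r_neq0 Q0).
  have := ltz_pmod (w - c%:Z) Q0.
  set s := (_ %% _)%Z; set q := (_ %/ _)%Z => s1 s2 E; split=> //; last by lia.
  suff : s <> 0 by lia.
  move=> s0; apply: wc; have -> : w = q * Q%:Z + c%:Z by lia.
  by rewrite modzMDl modz_small.
have := real_floorD1_gt (num_real (v / L)); have := floor_le (v / L).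
have := real_floorD1_gt (num_real (v' / L)); have := floor_le (v' / L).
rewrite -/(cell L v) -/(cell L v'); move: (cell L v) (cell L v') => w w' h1 h2 h3 h4.
move=> /key[q [s [-> E s1 s2]]] /key[q' [s' [-> E' s1' s2']]].
have vL : v = v / L * L by rewrite mulfVK// gt_eqF.
have vL' : v' = v' / L * L by rewrite mulfVK// gt_eqF.
have dv : `|v - v'| = `|v / L - v' / L| * L.
  by rewrite [in LHS]vL [in LHS]vL' -mulrBl normrM (gtr0_norm L0).
rewrite dv; split=> [qq|qq].
  apply: ler_wpM2r; [exact: ltW|rewrite ler_norml].
  have H1 : w + 1 <= w' + Q%:Z by lia.
  have H2 : w' + 1 <= w + Q%:Z by lia.
  move: H1 H2 h1 h2 h3 h4; rewrite -!(ler_int R) !intrD /= => H1 H2 h1 h2 h3 h4.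
  by rewrite -!pmulrn in H1 H2 *; apply/andP; split; lra.
rewrite -[leLHS]mul1r; apply: ler_wpM2r; first exact: ltW.
(* The deleted cell lies strictly between the two cells. *)
have H : w + 2 <= w' \/ w' + 2 <= w.
  have [qq'|qq'] : q + 1 <= q' \/ q' + 1 <= q by lia.
    by left; nia.
  by right; nia.
case: H; rewrite -(ler_int R) intrD => H.
  by rewrite distrC; apply: le_trans (ler_norm _); move: h1 h2 h3 h4 H; rewrite !intrD; lra.
by apply: le_trans (ler_norm _); move: h1 h2 h3 h4 H; rewrite !intrD; lra.
Qed.

Lemma slabs_sep L Q n c x y : 0 < L -> (c < Q)%N -> Rn n x -> Rn n y ->
  avoids L Q n c x -> avoids L Q n c y ->
  (slabs L Q n c x = slabs L Q n c y -> mdist x y <= Q%:R * L) /\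
  (slabs L Q n c x <> slabs L Q n c y -> L <= mdist x y).
Proof.
move=> L0 cQ xn yn xa ya; split=> H.
  apply: finseq_dist_le => [|m]; first by rewrite mulr_ge0// ltW.
  have [mn|mn] := ltnP m n; last by rewrite xn// yn// subrr normr0 mulr_ge0// ltW.
  have [+ _] := slab_sep L0 cQ (xa m mn) (ya m mn); apply.
  by have := congr1 (@^~ m) H; rewrite /slabs mn.
have [m Hm] : exists m, slabs L Q n c x m <> slabs L Q n c y m.
  by apply: contrapT => /forallNP H'; apply: H; apply/funext => m; apply: contrapT; exact: H'.
apply: le_trans (finseq_dist_ge _ _ m); move: Hm; rewrite /slabs.
case: ltnP => // mn Hm; have [_] := slab_sep L0 cQ (xa m mn) (ya m mn); exact.
Qed.

Lemma avoids_ex L Q n x (S : seq nat) : (size S < Q)%N ->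
  (forall m, (m < n)%N -> colour L Q (x m) \in S) ->
  exists2 c, (c < Q)%N & avoids L Q n c x.
Proof.
move=> SQ H; have [c cQ cS] : exists2 c, c \in iota 0 Q & c \notin S.
  apply/hasP; rewrite has_predC; apply/negP => /allP QS.
  by have := uniq_leq_size (iota_uniq 0 Q) QS; rewrite size_iota leqNgt SQ.
exists c; first by move: cQ; rewrite mem_iota.
by move=> m mn E; move: cS; rewrite -E H.
Qed.

Lemma avoids_dim L Q n x : (n < Q)%N -> exists2 c, (c < Q)%N & avoids L Q n c x.
Proof.
move=> nQ; apply: (@avoids_ex _ _ _ _ [seq colour L Q (x m) | m <- iota 0 n]).
  by rewrite size_map size_iota.
by move=> m mn; apply/mapP; exists m => //; rewrite mem_iota.
Qed.

(** Here v / 2^l is an integer divisible by 2^q. *)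
Lemma colour_grid l q i v : (q + l <= i)%N -> v \in pow2Z i ->
  colour (2 ^+ l) (2 ^ q) v = 0%N :> nat.
Proof.
move=> qli; rewrite inE => /intrP[z zE].
have p0 n : (2 ^+ n : R) != 0 by rewrite expf_neq0 ?pnatr_eq0.
rewrite /colour /cell.
have -> : v / 2 ^+ l = (z * (2 ^ (i - l - q))%N%:Z * (2 ^ q)%N%:Z)%:~R.
  rewrite !intrM -zE -!pmulrn !natrX -mulrA -exprD.
  have -> : (i - l - q + q = i - l)%N by lia.
  have il : (l <= i)%N by lia.
  rewrite -[in RHS](subnK il) addnK exprD; move: (p0 (i - l)%N) (p0 l).
  by move=> a0 b0; field; rewrite a0 b0.
by rewrite intrKfloor modzMl.
Qed.

(** All but [k] coordinates have colour 0, so at most k + 1 colours occur. The number of colours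
    needed does not grow with the ambient dimension [i]. *)
Lemma avoids_grid l q k i x : (q + l <= i)%N -> (k < (2 ^ q).-1)%N ->
  Ywk_part k i x -> exists2 c, (c < 2 ^ q)%N & avoids (2 ^+ l) (2 ^ q) i c x.
Proof.
move=> qli kq [_ xk].
pose S := 0%N :: [seq colour (2 ^+ l) (2 ^ q) (x (m : 'I_i)) |
  m <- enum [pred m : 'I_i | x m \notin pow2Z i]].
apply: (@avoids_ex _ _ _ _ S).
  rewrite /= size_map -cardE; apply: (@leq_ltn_trans k.+1); first by rewrite ltnS.
  by move: kq; case: (2 ^ q)%N.
move=> m mi; rewrite inE; have [/(colour_grid qli) ->|nm] := boolP (x m \in pow2Z i).
  by rewrite eqxx.
apply/orP; right; apply/mapP; exists (Ordinal mi) => //.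
by rewrite mem_enum inE.
Qed.

(** Slab pieces in a union: [key] tells apart the parts that are far from each other, and within a
    part [vec] is faithful up to the additive error [E]. *)
Lemma piece_slabs (X : metricType R) (P : set X) (K : Type) (key : X -> K)
    (vec : X -> finseq R) (dim : X -> nat) (E r L : R) (Q c : nat) :
  0 < L -> r + 1 <= L -> (c < Q)%N ->
  (forall x : X, P x -> Rn (dim x) (vec x) /\ avoids L Q (dim x) c (vec x)) ->
  (forall x y : X, P x -> P y -> mdist (vec x) (vec y) <= mdist x y) ->
  (forall x y : X, P x -> P y -> key x = key y ->
     dim x = dim y /\ mdist x y <= mdist (vec x) (vec y) + E) ->
  (forall x y : X, P x -> P y -> key x <> key y -> r + 1 <= mdist x y) ->
  piece r P.
Proof.
move=> L0 rL cQ PR Pv Pk Pn.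
exists (K * (nat -> int))%type, (fun x : X => (key x, slabs L Q (dim x) c (vec x))), (Q%:R * L + E).
move=> x y Px Py; have [xR xa] := PR x Px; have [yR ya] := PR y Py; split.
  move=> [kxy sxy]; have [dxy] := Pk x y Px Py kxy; move/le_trans; apply; rewrite lerD2r.
  rewrite -dxy in yR ya sxy.
  by have [+ _] := slabs_sep L0 cQ xR yR xa ya; apply.
move=> nxy; have [kxy|] := pselect (key x = key y); last exact: Pn.
have [dxy _] := Pk x y Px Py kxy; apply: le_trans rL (le_trans _ (Pv _ _ Px Py)).
rewrite -dxy in yR ya nxy.
have [_] := slabs_sep L0 cQ xR yR xa ya; apply => sxy; apply: nxy.
by rewrite kxy sxy.
Qed.

End slabs.

Lemma as_gap_ge l k : l <> k -> ((maxn l k).-1 <= as_gap l k)%N.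
Proof.
move=> lk; rewrite /as_gap; have lk' : (minn l k < maxn l k)%N by lia.
by case: (maxn l k) lk' => // M lM; rewrite big_nat_recr //= leq_addl.
Qed.

Lemma as_gap_le l k M : (l <= M)%N -> (k <= M)%N -> (as_gap l k <= M * M)%N.
Proof.
move=> lM kM; rewrite /as_gap.
apply: (@leq_trans (\sum_(minn l k <= j < maxn l k) M)).
  rewrite big_nat [leqRHS]big_nat; apply: leq_sum => j; lia.
by rewrite sum_nat_const_nat leq_mul2r; apply/orP; right; lia.
Qed.

Lemma as_gapxx l : as_gap l l = 0%N.
Proof. by rewrite /as_gap minnn maxnn big_geq. Qed.

Lemma ltn_pow2 n : (n < 2 ^ n)%N. Proof. exact: ltn_expl. Qed.

Section asunion_theory.
Context {R : realType} {Z : metricType R} (S : nat -> set Z).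

Lemma asunion_mem (p : asunion S) : (0 < as_idx p)%N /\ S (as_idx p) (as_pt p).
Proof. exact: (set_valP p). Qed.

Lemma asunion_point i x : (0 < i)%N -> S i x ->
  exists p : asunion S, as_idx p = i /\ as_pt p = x.
Proof.
move=> i0 Sx; have H : (i, x) \in [set p : nat * Z | (0 < p.1)%N /\ S p.1 p.2].
  exact: mem_set.
by exists (exist _ (i, x) H).
Qed.

Lemma asunion_inj (p q : asunion S) : as_idx p = as_idx q -> as_pt p = as_pt q -> p = q.
Proof.
move=> ei ep; apply: mdist_positivity.
by rewrite as_mdistE ei ep mdistxx as_gapxx addr0.
Qed.

Lemma asunion_gap_ge (p q : asunion S) b : as_idx p <> as_idx q ->
  (b < maxn (as_idx p) (as_idx q))%N -> b%:R <= mdist p q.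
Proof.
move=> pq bm; rewrite as_mdistE; apply: (@le_trans _ _ (as_gap (as_idx p) (as_idx q))%:R).
  by rewrite ler_nat; apply: leq_trans (as_gap_ge pq); lia.
by rewrite lerDr mdist_ge0.
Qed.

Lemma asunion_pt_le (p q : asunion S) : mdist (as_pt p) (as_pt q) <= mdist p q.
Proof. by rewrite as_mdistE lerDl ler0n. Qed.

Lemma zmetric_asunion :
  (forall i j x y, S i x -> S j y -> exists n : nat, mdist x y = n%:R) ->
  zmetric (asunion S).
Proof.
move=> H p q; have [_ Sp] := asunion_mem p; have [_ Sq] := asunion_mem q.
have [n nE] := H _ _ _ _ Sp Sq.
exists (n + as_gap (as_idx p) (as_idx q))%N; by rewrite as_mdistE nE natrD.
Qed.

End asunion_theory.

Lemma Rn_le (R : realType) n m (x : finseq R) : (n <= m)%N -> Rn n x -> Rn m x.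
Proof. by move=> nm xn j mj; apply: xn; lia. Qed.

(** * Asymptotic unions of lattice powers *)

Section power_union.
Context {R : realType} (K G : nat -> nat).
Let X : metricType R := asunion (fun i => pow2Zn (K i) (G i) : set (finseq R)).

Lemma zmetric_power : zmetric X.
Proof. by apply: zmetric_asunion => i j x y; exact: pow2Zn_dist. Qed.

(** The summands of large index are discrete at scale [a] and form [P0]; the finitely many others
    sit in one R^n up to bounded gaps and are covered by n + 1 slab pieces. [Q] does not depend on
    [r], as dimension omega demands. *)
Lemma power_pieces (a : nat) : (forall k, exists i0, forall i, (i0 <= i)%N -> (k <= K i)%N) ->
  exists Q, forall r, exists (P0 : set X) (P : nat -> set X),
    [/\ piece a%:R P0, forall c, (c < Q)%N -> piece r%:R (P c)
      & forall x, P0 x \/ exists2 c, (c < Q)%N & P c x].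
Proof.
move=> /(_ a)[i0 Hi0]; pose M := maxn i0 a.+1.
pose n := (\sum_(i < M) G i)%N.
have Gn i : (i < M)%N -> (G i <= n)%N.
  by move=> iM; rewrite /n (bigD1 (Ordinal iM))//= leq_addr.
exists n.+1 => r.
pose P c := [set p : X | (as_idx p < M)%N /\ avoids r.+1%:R n.+1 n c (as_pt p)].
exists [set p : X | (M <= as_idx p)%N], P; split.
- exists X, id, 0 => p q /= Mp Mq; split=> [->|pq]; first by rewrite mdistxx.
  rewrite natr1; have [ei|ni] := pselect (as_idx p = as_idx q); last first.
    apply: asunion_gap_ge => //; have := leq_maxr i0 a.+1; rewrite -/M; lia.
  apply: le_trans (asunion_pt_le _ _).
  have [_ Sp] := asunion_mem p; have [_ Sq] := asunion_mem q.
  rewrite -ei in Sq; apply: le_trans (pow2Zn_sep Sp Sq _); last first.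
    by move=> ep; apply: pq; exact: asunion_inj.
  rewrite -natrX ler_nat; apply: leq_trans (ltn_pow2 a) _.
  rewrite leq_exp2l//; apply: Hi0; have := leq_maxl i0 a.+1; rewrite -/M; lia.
- move=> c cn; apply: (@piece_slabs _ X _ unit (fun=> tt) (@as_pt _ _ _) (fun=> n)
    (M * M)%:R _ r.+1%:R n.+1 c) => //.
  + by rewrite natr1.
  + move=> p [pM pa]; split=> //; have [_ [pR _]] := asunion_mem p.
    exact: Rn_le (Gn _ pM) pR.
  + by move=> p q _ _; exact: asunion_pt_le.
  + move=> p q [pM _] [qM _] _; split=> //; rewrite as_mdistE lerD2l ler_nat.
    by apply: as_gap_le; lia.
- move=> p; have [Mp|pM] := leqP M (as_idx p); first by left.
  by right; have [c cn pa] := avoids_dim r.+1%:R (as_pt p) (ltnSn n); exists c.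
Qed.

Lemma power_grid i : (0 < i)%N -> exists e : (nat -> nat) -> X, gridlike (G i) (2 ^+ K i) e.
Proof.
move=> i0; have H u : exists p : X, as_idx p = i /\ as_pt p = lattice (G i) (2 ^+ K i) u.
  by apply: asunion_point => //; exact: lattice_pow2Zn.
have [e He] := choice H; exists e; split=> [u v uv|u v j jn].
  have [iu pu] := He u; have [iv pv] := He v.
  rewrite as_mdistE iu iv as_gapxx addr0 pu pv -[leRHS]mulr1.
  by apply: (@lattice_dist_le _ _ _ _ _ 1%N) => [|m _]; [exact: exprn_ge0|have := uv m; lia].
have [iu pu] := He u; have [iv pv] := He v; apply: le_trans (asunion_pt_le _ _).
rewrite pu pv; have [vu|uv] := leqP (v j) (u j).
  by apply: le_trans (mdist_ge0 _ _); rewrite subr_le0 ler_nat.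
apply: le_trans (lattice_dist_ge _ _ _ jn); last exact: exprn_ge0.
by rewrite ler_peMl ?subr_ge0 ?ler_nat 1?ltnW// exprn_ege1// ler1n.
Qed.

End power_union.

(** * The dimension function of a single lattice power *)

Section power_space.
Context {R : realType} (k n : nat).
Let X : metricType R := set_type (pow2Zn k n : set (finseq R)).

Lemma pow2Zn_ad_ge (l : R) : 2 ^+ k < l -> (n%:R%:E <= ad X l)%E.
Proof.
move=> kl; have H u : exists p : X, set_val p = lattice n (2 ^+ k) u.
  have H : lattice n (2 ^+ k) u \in (pow2Zn k n : set (finseq R)).
    exact/mem_set/lattice_pow2Zn.
  by exists (exist (fun x => x \in pow2Zn k n) _ H).
have [e He] := choice H; apply: (@ad_gridlike _ _ _ (2 ^+ k) e) => //.
split=> [u v uv|u v j jn].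
  rewrite -[mdist _ _]/(mdist (set_val (e u)) (set_val (e v))) !He -[leRHS]mulr1.
  by apply: (@lattice_dist_le _ _ _ _ _ 1%N) => [|m _]; [exact: exprn_ge0|have := uv m; lia].
rewrite -[mdist _ _]/(mdist (set_val (e u)) (set_val (e v))) !He.
have [vu|uv] := leqP (v j) (u j).
  by apply: le_trans (mdist_ge0 _ _); rewrite subr_le0 ler_nat.
apply: le_trans (lattice_dist_ge _ _ _ jn); last exact: exprn_ge0.
by rewrite ler_peMl ?subr_ge0 ?ler_nat 1?ltnW// exprn_ege1// ler1n.
Qed.

Lemma pow2Zn_ad_le (l : R) : 0 < l -> (ad X l <= n%:R%:E)%E.
Proof.
move=> l0; have L0 : 0 < l + l + 1 by rewrite !addr_gt0.
have [c cn|x|U Ul Un] := @pieces_admissible _ X l n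
    (fun c => [set p : X | avoids (l + l + 1) n.+1 n c (set_val p)]) l0.
- apply: (@piece_slabs _ X _ unit (fun=> tt) (fun p => set_val p) (fun=> n)
    0 _ (l + l + 1) n.+1 c) => //.
    by move=> p pa; split=> //; have [] := set_valP p.
  by move=> p q _ _ _; rewrite addr0.
- by have [c cn pa] := avoids_dim (l + l + 1) (set_val x) (ltnSn n); exists c.
- exact: ad_le Ul Un.
Qed.

Lemma pow2Zn_ad_le0 (l : R) : 0 < l -> l <= 2 ^+ k -> (ad X l <= 0)%E.
Proof.
move=> l0 lk; apply: ad_discrete => // p q pq; apply: le_trans lk _.
apply: pow2Zn_sep (set_valP p) (set_valP q) _ => e; apply: pq; exact: val_inj.
Qed.

End power_space.

(** * The space Y *)

Section Y_space.
Variable R : realType.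
Let Y : metricType R := Y2w R.

Definition Ylevel (p : Y2w R) : nat := as_idx p.
Definition Yindex (p : Y2w R) : nat := as_idx (as_pt p).
Definition Yvec (p : Y2w R) : finseq R := as_pt (as_pt p).

Lemma Y_mem (p : Y) : [/\ (0 < Ylevel p)%N, (0 < Yindex p)%N
  & Ywk_part (Ylevel p) (Yindex p) (Yvec p)].
Proof. by have [? ?] := asunion_mem p; have [? _] := asunion_mem (as_pt p). Qed.

Lemma Y_Rn (p : Y) : Rn (Yindex p) (Yvec p).
Proof. by have [_ _ [[]]] := Y_mem p. Qed.

Lemma Y_point k i x : (0 < k)%N -> (0 < i)%N -> Ywk_part k i x ->
  exists p : Y, [/\ Ylevel p = k, Yindex p = i & Yvec p = x].
Proof.
move=> k0 i0 [[xR xZ] xk].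
have [z [zi zx]] : exists z : asRn R, as_idx z = i /\ as_pt z = x by exact: asunion_point.
have [p [pk pz]] : exists p : Y, as_idx p = k /\ as_pt p = z.
  by apply: asunion_point => //; rewrite /Ywk /= zi zx.
by exists p; rewrite /Ylevel /Yindex /Yvec pz zi zx.
Qed.

Lemma Y_distE (p q : Y) : mdist p q = mdist (Yvec p) (Yvec q) +
  (as_gap (Yindex p) (Yindex q))%:R + (as_gap (Ylevel p) (Ylevel q))%:R.
Proof. by []. Qed.

Lemma Yvec_le (p q : Y) : mdist (Yvec p) (Yvec q) <= mdist p q.
Proof. by rewrite Y_distE -addrA lerDl addr_ge0. Qed.

Lemma Yindex_gap (p q : Y) b : Yindex p <> Yindex q ->
  (b < maxn (Yindex p) (Yindex q))%N -> b%:R <= mdist p q.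
Proof.
move=> pq bm; apply: le_trans (asunion_pt_le p q); exact: asunion_gap_ge.
Qed.

Lemma zmetric_Y : zmetric Y.
Proof.
move=> p q; have [_ _ [pZ _]] := Y_mem p; have [_ _ [qZ _]] := Y_mem q.
have [n nE] := pow2Zn_dist pZ qZ.
exists (n + as_gap (Yindex p) (Yindex q) + as_gap (Ylevel p) (Ylevel q))%N.
by rewrite Y_distE nE !natrD.
Qed.

(** The quantifiers mirror the bound 2 omega: [a] fixes the number of pieces at scale [r1], and [r1]
    the number at scale [r2]. Levels from [k] on have mesh and gaps above [a]; at lower levels the
    large indices need few colours by [avoids_grid], and the small ones span a bounded dimension. *)
Lemma Y_pieces (a : nat) : exists Q, (0 < Q)%N /\ forall r1, exists Q', forall r2,
  exists (P0 : set Y) (P1 P2 : nat -> set Y),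
  [/\ piece a%:R P0, forall c, (c < Q)%N -> piece r1%:R (P1 c),
      forall c, (c < Q')%N -> piece r2%:R (P2 c)
    & forall x, [\/ P0 x, exists2 c, (c < Q)%N & P1 c x | exists2 c, (c < Q')%N & P2 c x]].
Proof.
(* 2^q exceeds the number of colours used by [avoids_grid] at levels below [k]; below, 2^l exceeds
   [r1], and [colour_grid] applies from index [i0] on. *)
pose k := a.+3; pose q := k.+1; exists (2 ^ q)%N; split; first by rewrite expn_gt0.
move=> r1; pose l := r1.+1; pose i0 := (q + l)%N.
exists i0.+1 => r2.
pose P1 c := [set p : Y | [/\ (Ylevel p < k)%N, (i0 <= Yindex p)%N &
   avoids (2 ^+ l) (2 ^ q) (Yindex p) c (Yvec p)]].
pose P2 c := [set p : Y | [/\ (Ylevel p < k)%N, (Yindex p < i0)%N &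
   avoids r2.+1%:R i0.+1 i0 c (Yvec p)]].
exists [set p : Y | (k <= Ylevel p)%N], P1, P2; split.
(* Indices up to [k] are identified, since gaps between them may be small; this costs a diameter of
   at most [k * k]. *)
- exists (nat * nat * finseq R)%type, (fun p => (Ylevel p, maxn (Yindex p) k, Yvec p)), (k * k)%:R.
  move=> x y /= kx ky; split=> [[el ei ev]|xy].
    rewrite Y_distE el as_gapxx ev mdistxx add0r addr0 ler_nat.
    have [->|ne] := eqVneq (Yindex x) (Yindex y); first by rewrite as_gapxx.
    by apply: as_gap_le; lia.
  rewrite natr1; have [el|nl] := pselect (Ylevel x = Ylevel y); last first.
    by apply: asunion_gap_ge => //; move: kx ky; rewrite /Ylevel /k; lia.
  have [ei|ni] := pselect (maxn (Yindex x) k = maxn (Yindex y) k); last first.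
    by apply: Yindex_gap; [move=> e; apply: ni; rewrite e|rewrite /k in ni *; lia].
  apply: le_trans (Yvec_le _ _).
  have [_ _ [xZ _]] := Y_mem x; have [_ _ [yZ _]] := Y_mem y; rewrite -el in yZ.
  apply: le_trans (pow2Zn_sep xZ yZ _); last by move=> e; apply: xy; rewrite el ei e.
  rewrite -natrX ler_nat; apply: leq_trans (ltnW (ltn_pow2 _)).
  by move: kx; rewrite /k; lia.
- move=> c cQ; apply: (@piece_slabs _ Y _ _ Yindex Yvec Yindex (k * k)%:R _ (2 ^+ l) (2 ^ q) c) => //.
  + by rewrite natr1 -natrX ler_nat ltnW// ltn_pow2.
  + by move=> p [_ _ pa]; split=> //; exact: Y_Rn.
  + by move=> p q' _ _; exact: Yvec_le.
  + move=> x y [xk _ _] [yk _ _] e; split=> //; rewrite Y_distE e as_gapxx addr0 lerD2l ler_nat.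
    by apply: as_gap_le; lia.
  + move=> x y [_ xi _] [_ yi _] e; rewrite natr1; apply: Yindex_gap => //.
    by move: xi yi; rewrite /i0 /l /q; lia.
- move=> c cQ; apply: (@piece_slabs _ Y _ unit (fun=> tt) Yvec (fun=> i0)
    (i0 * i0 + k * k)%:R _ r2.+1%:R i0.+1 c) => //.
  + by rewrite natr1.
  + move=> p [_ pi pa]; split=> //. exact (Rn_le (ltnW pi) (@Y_Rn p)).
  + by move=> p q' _ _; exact: Yvec_le.
  + move=> x y [xk xi _] [yk yi _] _; split=> //; rewrite Y_distE -addrA lerD2l natrD.
    by apply: lerD; rewrite ler_nat; apply: as_gap_le; lia.
- move=> p; have [kp|pk] := leqP k (Ylevel p); first by apply: Or31.
  have [ip|pi] := leqP i0 (Yindex p).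
    apply: Or32; have [_ _ pY] := Y_mem p.
    have kq : (Ylevel p < (2 ^ q).-1)%N.
      by have := ltn_pow2 q; rewrite {1}/q; lia.
    by have [c cQ pa] := avoids_grid ip kq pY; exists c.
  by apply: Or33; have [c cQ pa] := avoids_dim r2.+1%:R (Yvec p) (ltnSn i0); exists c.
Qed.

(** Finiteness of [ad] for Y, with all pieces of [Y_pieces] taken at one scale of at least
    [l + l]. *)
Lemma Y_admissible (l : R) : 0 < l -> exists n U, admissible l (U : set (set Y)) /\
  forall k, overlap k U -> (k <= n)%N.
Proof.
move=> l0; have [a la] : exists a : nat, l + l <= a%:R.
  by exists (Num.bound (l + l)); rewrite ltW// archi_boundP// addr_ge0 ?ltW.
have [Q [Q0 /(_ a)[Q' /(_ a)[P0 [P1 [P2 [H0 H1 H2 H]]]]]]] := Y_pieces a.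
pose P c := if c == 0%N then P0 else if (c <= Q)%N then P1 c.-1 else P2 (c - Q).-1.
have [c cQ|x|U Ul Un] := @pieces_admissible _ Y l (Q + Q') P l0.
- apply: piece_le la _; rewrite /P; case: c cQ => //= c cQ.
  by case: ltnP => cQ'; [exact: H1|apply: H2; lia].
- case: (H x) => [Px|[c cQ Px]|[c cQ Px]].
  + by exists 0%N.
  + by exists c.+1; [lia|rewrite /P /= cQ].
  + exists (Q + c).+1; first by lia.
    by rewrite /P /= ltnNge leq_addr /= -addnS addKn.
- by exists (Q + Q').+1, U.
Qed.

Lemma g_funE (l : R) : 0 < l -> exists m : nat, ad Y l = m%:R%:E /\ g_fun l = m.+1.
Proof.
move=> l0; have [n [U [Ul Un]]] := Y_admissible l0.
have [p _] : exists p : Y, [/\ Ylevel p = 1%N, Yindex p = 1%N & Yvec p = lattice 1 (2 ^+ 1) (fun=> 0%N)].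
  apply: Y_point => //; split; first exact: lattice_pow2Zn.
  by apply: leq_trans (max_card _) _; rewrite card_ord.
have [m [Em Em1 _]] := ad_nat p Ul Un; exists m; split=> //.
rewrite /g_fun; case: xgetP => [j _ /= /eqP|/(_ m.+1)]; last by rewrite /= Em1.
by rewrite Em1 eqe eqr_nat => /eqP.
Qed.

(** A vector of length k has at most k coordinates off the grid, so at level and index k the summand
    is the whole lattice (2^k Z)^k. *)
Lemma Y_grid k : (0 < k)%N -> exists e : (nat -> nat) -> Y, gridlike k (2 ^+ k) e.
Proof.
move=> k0; have H u : exists p : Y, [/\ Ylevel p = k, Yindex p = k
    & Yvec p = lattice k (2 ^+ k) u].
  apply: Y_point => //; split; first exact: lattice_pow2Zn.
  by apply: leq_trans (max_card _) _; rewrite card_ord.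
have [e He] := choice H; exists e; split=> [u v uv|u v j jn].
  have [ku iu pu] := He u; have [kv iv pv] := He v.
  rewrite Y_distE ku iu kv iv !as_gapxx !addr0 pu pv -[leRHS]mulr1.
  by apply: (@lattice_dist_le _ _ _ _ _ 1%N) => [|m _]; [exact: exprn_ge0|have := uv m; lia].
have [_ _ pu] := He u; have [_ _ pv] := He v; apply: le_trans (Yvec_le _ _).
rewrite pu pv; have [vu|uv] := leqP (v j) (u j).
  by apply: le_trans (mdist_ge0 _ _); rewrite subr_le0 ler_nat.
apply: le_trans (lattice_dist_ge _ _ _ jn); last exact: exprn_ge0.
by rewrite ler_peMl ?subr_ge0 ?ler_nat 1?ltnW// exprn_ege1// ler1n.
Qed.

Lemma g_fun_gt k (l : R) : (0 < k)%N -> 2 ^+ k < l -> (k < g_fun l)%N.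
Proof.
move=> k0 kl; have [|m [Em ->]] := @g_funE l.
  by apply: le_lt_trans kl; exact: exprn_ge0.
have [e /ad_gridlike/(_ _ kl)] := Y_grid k0.
by rewrite Em lee_fin ler_nat.
Qed.

Lemma Y_trasdim_up a : exists k, forall B : {fset nat}, #|` B| = k.+1 -> a \notin B ->
  (forall i, i \in B -> (0 < i)%N) ->
  exists m, forall s, Acoll Y s -> a \in s -> (B `<=` s)%fset -> (#|` s| <= m)%N.
Proof.
have [Q0 [+ HQ]] := Y_pieces a; case: Q0 HQ => // Q HQ _; exists Q => B BQ aB _.
have [Q' HQ'] := HQ (\sum_(j <- enum_fset B) j)%N.
exists (Q.+1 + Q')%N => s As as_ Bs; rewrite leqNgt; apply/negP => sQ.
have [P0 [P1 [P2 [H0 H1 H2 H]]]] := HQ' (\sum_(j <- enum_fset s) j)%N.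
by apply: (Acoll_pieces3 as_ Bs aB BQ sQ (@fset_le_sum B) (@fset_le_sum s) H0 H1 H2 H).
Qed.

End Y_space.

(** * The space X *)

Section X_space.
Variable R : realType.
Let g : R -> nat := @g_fun R.
Let X : metricType R := Xw g.

(** At scales up to the mesh the lattice is discrete and [ad] is at most 0, whereas [g] is at least
    1; above the mesh [ad] equals the rank. *)
Lemma g_tilde_cond (i : nat) (k : nat) : (0 < i)%N -> (0 < k)%N ->
  ad (set_type (pow2Zn k (g i%:R)) : metricType R) i%:R = (g i%:R)%:R%:E <-> (2 ^ k < i)%N.
Proof.
move=> i0 k0; have i0' : 0 < i%:R :> R by rewrite ltr0n.
have [m [_ gE]] := g_funE i0'; split=> [E|ki].
  rewrite ltnNge; apply/negP => ik.
  have := @pow2Zn_ad_le0 R k (g i%:R) i%:R i0' _.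
  by rewrite E -natrX ler_nat ik lee_fin (ler_nat _ _ 0) /g gE => /(_ isT).
by apply/eqP; rewrite eq_le pow2Zn_ad_le// pow2Zn_ad_ge// -natrX ltr_nat.
Qed.

Lemma g_tilde_ge (i k : nat) : (0 < k)%N -> (2 ^ k < i)%N -> (k <= g_tilde g i%:R)%N.
Proof.
move=> k0 ki; have i0 : (0 < i)%N by lia.
pose Q := fun j => (0 < j)%N && (2 ^ j < i)%N.
have QE j : Q j <-> (0 < j)%N /\ ad (set_type (pow2Zn j (g i%:R)) : metricType R) i%:R
    = (g i%:R)%:R%:E.
  split=> [/andP[j0 /g_tilde_cond]|[j0 /g_tilde_cond H]]; first by move=> H; split=> //; apply: H.
  by apply/andP; split=> //; apply: H.
have Qb j : Q j -> (j <= i)%N.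
  by case/andP=> _ ji; have := ltn_pow2 j; lia.
have Qk : exists j, Q j by exists k; rewrite /Q k0.
case: (ex_maxnP Qk Qb) => M QM Mmax.
rewrite /g_tilde /maxnat; case: xgetP => [x _ [_ xmax]|/(_ M) []].
  by apply: xmax; apply/QE; rewrite /Q k0.
by split; [exact/QE|move=> j /QE; exact: Mmax].
Qed.

Lemma g_tilde_lt (i : nat) : (1 < i)%N -> (2 ^ g_tilde g i%:R < i)%N.
Proof.
move=> i1; rewrite /g_tilde /maxnat; case: xgetP => [x _ [[x0 +] _]|_]; last first.
  (* The default value 0 gives mesh 1, still below [i]. *)
  by rewrite expn0.
by move=> /g_tilde_cond; apply => //; lia.
Qed.

Lemma nat_ceil (r : R) : 0 < r -> exists i : nat, i%:R < r /\ r <= i.+1%:R.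
Proof.
move=> r0; have H : exists n : nat, r <= n%:R.
  by exists (Num.bound r); rewrite ltW// archi_boundP// ltW.
case: (ex_minnP H) => -[|i] ri imin; first by have := lt_le_trans r0 ri; rewrite ltxx.
by exists i; split=> //; rewrite ltNge; apply/negP => /imin; rewrite ltnn.
Qed.

Lemma g_fun_lt_ad (r : R) : 0 < r -> (ad (Y2w R) r < (g r)%:R%:E)%E.
Proof.
by move=> r0; have [m [-> gE]] := g_funE r0; rewrite /g gE lte_fin ltr_nat.
Qed.

(** Both sides are constant on ]i, i + 1], so [r] may be raised to i + 1, where the summand of that
    index is a lattice of rank [g] and mesh below i + 1. For 0 < r <= 1 the space is r-discrete, so
    [ad] is at most 0 while [g] is at least 1; hence the range 1 < r. *)
Lemma X_ad_ge (r : R) : 1 < r -> ((g r)%:R%:E <= ad X r)%E.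
Proof.
move=> r1; have [i [ir ri]] := nat_ceil (lt_trans ltr01 r1).
have i0 : (0 < i)%N.
  by rewrite lt0n; apply/eqP => i0; move: ri; rewrite i0 leNgt r1.
have -> : g r = g i.+1%:R by rewrite /g /g_fun (ad_zmetric (@zmetric_Y R) ir ri).
rewrite (ad_zmetric (@zmetric_power R (fun i => g_tilde g i%:R) (fun i => g i%:R)) ir ri).
have [e He] := @power_grid R (fun i => g_tilde g i%:R) (fun i => g i%:R) i.+1 isT.
by apply: (ad_gridlike He); rewrite -natrX ltr_nat g_tilde_lt.
Qed.

Lemma X_trasdim : trasdim_eq X toomega.
Proof.
apply: trasdim_omega => [a a0|n].
  have [|Q HQ] := @power_pieces R (fun i => g_tilde g i%:R) (fun i => g i%:R) a.
    move=> k; exists (2 ^ k.+1).+1 => i ki; apply: ltnW; exact: g_tilde_ge.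
  exists Q => s Xs as_; rewrite leqNgt; apply/negP => sQ.
  have [P0 [P [H0 H1 H]]] := HQ (\sum_(j <- enum_fset s) j)%N.
  suff : ~ Acoll X s by [].
  apply: (@Acoll_pieces3 _ X s fset0 a 0%N Q 0%N _ P0 (fun=> set0) P as_ (fsub0set _) _
    (cardfs0 _) sQ _ (@fset_le_sum s) H0 _ H1) => // x.
  by have [Px|Px] := H x; [exact: Or31|exact: Or33].
(* A summand of rank above n + 1 puts n + 1 consecutive integers, starting at its mesh, into
   [Acoll X]. *)
pose i := (2 ^ n.+1).+1.
have gi : (n.+1 < g i%:R)%N by apply: g_fun_gt => //; rewrite -natrX ltr_nat.
have [e He] := @power_grid R (fun i => g_tilde g i%:R) (fun i => g i%:R) i isT.
pose c := (2 ^ g_tilde g i%:R)%N.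
pose s := [fset j in iota c n.+1]%fset.
have sn : #|` s| = n.+1 by rewrite card_fseq undup_id ?iota_uniq// size_iota.
have sc j : j \in s -> (c <= j)%N.
  by rewrite in_fset -[in_mem _ _]/(j \in iota c n.+1) mem_iota => /andP[].
exists s; last by rewrite sn.
apply: (Acoll_gridlike He).
- split; first by move=> s0; move: sn; rewrite s0 cardfs0.
  by move=> j /sc; apply: leq_trans; rewrite expn_gt0.
- by rewrite sn ltnW.
- by move=> j /sc; rewrite -natrX ler_nat.
Qed.

End X_space.

(** * The lower bound for Y *)

Section near_skeleton.
Local Open Scope nat_scope.

Section near_grid.
Variable H : nat.
Implicit Types s u q : nat.

(** Distance at most [s] to a multiple of [H]; the shift by [s] keeps the test within the
    naturals. *)
Definition grid_near s u : bool := (u + s) %% H <= s.*2.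

(* The cells of the grid HZ: even numbers are neighbourhoods of grid points, odd
   numbers the intervals between them. *)
Definition face s u : nat :=
  if grid_near s u then ((u + s) %/ H).*2 else (u %/ H).*2.+1.

Lemma multiple_le q q' : q * H < q' * H + H -> q <= q'.
Proof. by rewrite addnC -mulSn ltn_mul2r => /andP[_]. Qed.

Lemma nearE s u : grid_near s u -> exists2 q, q * H <= u + s <= q * H + s.*2 & (u + s) %/ H = q.
Proof.
rewrite /grid_near => us; exists ((u + s) %/ H) => //.
by rewrite [in X in _ <= X <= _](divn_eq (u + s) H) leq_addr leq_add2l.
Qed.

Lemma near_intro s u q : s.*2 < H -> q * H <= u + s <= q * H + s.*2 -> grid_near s u.
Proof.
move=> sH us; rewrite /grid_near; have -> : u + s = q * H + (u + s - q * H) by lia.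
by rewrite modnMDl modn_small; lia.
Qed.

Lemma near_succ s u : s.+1.*2 < H -> grid_near s u -> grid_near s.+1 u.
Proof. by move=> sH /nearE[q us _]; apply: (@near_intro _ _ q) => //; lia. Qed.

Lemma not_near s u : s.*2 < H -> ~~ grid_near s u ->
  (u %/ H) * H + s < u /\ u + s < (u %/ H) * H + H.
Proof.
move=> sH nu; have := divn_eq u H; have : u %% H < H by apply: ltn_pmod; lia.
set q := u %/ H; set r := u %% H => rH E; split; rewrite ltnNge; apply/negP => us.
  by move/negP: nu; apply; apply: (@near_intro _ _ q) => //; lia.
by move/negP: nu; apply; apply: (@near_intro _ _ q.+1) => //; rewrite mulSn; lia.
Qed.

(** A neighbour of a point s-near a multiple of [H] is (s + 1)-near the same multiple, hence s-near
    it. Cells change only across the shell between the two widths, which both points avoid. *)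
Lemma face_adj s u v : s.+1.*2 < H -> u <= v.+1 -> v <= u.+1 ->
  (grid_near s.+1 u -> grid_near s u) -> (grid_near s.+1 v -> grid_near s v) -> face s u = face s v.
Proof.
move=> sH uv vu su sv; rewrite /face; case: ifPn => nu.
  have [q us ->] := nearE nu.
  have nv : grid_near s v by apply/sv/(@near_intro _ _ q) => //; lia.
  have [q' vs ->] := nearE nv; rewrite nv.
  have : q <= q' by apply: multiple_le; lia.
  have : q' <= q by apply: multiple_le; lia.
  by lia.
case: ifPn => nv.
  have [q vs _] := nearE nv; move/negP: nu; case.
  by apply/su/(@near_intro _ _ q) => //; lia.
have sH' : s.*2 < H by lia.
have [u1 u2] := not_near sH' nu; have [v1 v2] := not_near sH' nv.
have : u %/ H <= v %/ H by apply: multiple_le; lia.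
have : v %/ H <= u %/ H by apply: multiple_le; lia.
by lia.
Qed.

Lemma face_le s u v : s.*2 < H -> face s u = face s v -> u <= v + H.
Proof.
rewrite /face => sH; case: ifPn => nu; case: ifPn => nv.
- have [q us ->] := nearE nu; have [q' vs ->] := nearE nv => /double_inj E.
  by move: us; rewrite E; lia.
- by move=> E; exfalso; lia.
- by move=> E; exfalso; lia.
have [u1 u2] := not_near sH nu; have [v1 v2] := not_near sH nv => E.
have E' : u %/ H = v %/ H by lia.
by move: u1 u2 v1 v2; rewrite E'; lia.
Qed.

End near_grid.

Lemma count_sub_eq (T : eqType) (a b : pred T) (l : seq T) :
  (forall j, a j -> b j) -> count b l <= count a l -> forall j, j \in l -> b j -> a j.
Proof.
move=> ab; elim: l => //= x l IH ba j.
have sl := sub_count ab l; have [ax|ax] := boolP (a x).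
  rewrite inE => /predU1P[->//|jl]; apply: IH => //.
  by move: ba; rewrite ax (ab _ ax) leq_add2l.
have bx : b x = false by apply/negbTE/negP => bx; move: ba; rewrite bx (negbTE ax); lia.
rewrite inE => /predU1P[->|jl]; first by rewrite bx.
by apply: IH => //; move: ba; rewrite bx (negbTE ax).
Qed.

Section rounding.
Variable m : nat.

(* Collapses the m-neighbourhoods of the multiples of h (2m + 1) to multiples of h,
   without moving neighbours apart. *)
Definition rnd u := (u + m) %/ m.*2.+1.

Lemma rnd_le u v d : u <= v + d -> rnd u <= rnd v + d.
Proof.
move=> uv; rewrite /rnd; apply: leq_trans (leq_div2r _ (_ : _ <= v + m + d * m.*2.+1)) _.
  by nia.
by rewrite divnDMl.
Qed.

Lemma rnd0 : rnd 0 = 0.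
Proof. by rewrite /rnd divn_small //; lia. Qed.

Variable h : nat.
Let H := h * m.*2.+1.

Lemma rnd_grid q : rnd (q * H) = q * h.
Proof. by rewrite /rnd /H mulnA divnMDl // divn_small ?addn0 //; lia. Qed.

Lemma near_rnd u : grid_near H m u -> exists q, rnd u = q * h.
Proof.
move=> /nearE[q um _]; exists q; rewrite /rnd.
have -> : u + m = q * h * m.*2.+1 + (u + m - q * H) by rewrite /H in um *; lia.
rewrite divnMDl // divn_small ?addn0 //; lia.
Qed.

End rounding.

Section levels.
Variables (H n K m : nat).
Hypotheses (nE : n = K.+1 + m) (mH : m.*2.+1 < H).
Implicit Types x : nat -> nat.

Definition far s x := count (fun j => ~~ grid_near H s (x j)) (iota 0 n).

(** No coordinate lies in the shell between the widths n - d and n - d + 1, as [face_adj]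
    requires. *)
Definition isface d x := forall j, j < n -> grid_near H (n - d).+1 (x j) -> grid_near H (n - d) (x j).

(** Take the least d > K + 1 with at most d coordinates far at width n - d. At the next width at
    least d are still far, by minimality, or by hypothesis when that width is m. So the two counts
    agree and the shell is empty. *)
Lemma far_level x : K.+1 < far m x -> exists d, [/\ K.+1 < d, d <= n & isface d x].
Proof.
move=> low; pose Q d := (K.+1 < d) && (far (n - d) x <= d).
have farn s : far s x <= n by rewrite -[X in _ <= X](size_iota 0 n) count_size.
have Kn : K.+1 < n by apply: leq_trans low (farn m).
have exQ : exists d, Q d by exists n; rewrite /Q Kn farn.
case: (ex_minnP exQ) => d /andP[Kd dfar] dmin.
have dn : d <= n by apply: dmin; rewrite /Q Kn farn.
exists d; split=> // j jn jnear; apply/negPn/negP => nj.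
have dfar' : d <= far (n - d).+1 x.
  have E : (n - d).+1 = n - d.-1 by lia.
  have [dK|dK] := eqVneq d.-1 K.+1.
    rewrite E dK; have -> : n - K.+1 = m by lia.
    by lia.
  rewrite E leqNgt; apply/negP => lt; have : d <= d.-1; last by lia.
  by apply: dmin; apply/andP; split; lia.
move: jnear; apply/negP.
apply: (@count_sub_eq _ (fun j => ~~ grid_near H (n - d).+1 (x j)) (fun j => ~~ grid_near H (n - d) (x j))
    (iota 0 n)) nj => [i| |].
- by apply: contra; apply: near_succ; lia.
- exact: leq_trans dfar dfar'.
- by rewrite mem_iota.
Qed.

Definition faces d x j := if j < n then face H (n - d) (x j) else 0.

Lemma faces_adj d x y : K.+1 < d -> d <= n -> (forall j, x j <= (y j).+1 /\ y j <= (x j).+1) ->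
  isface d x -> isface d y -> faces d x = faces d y.
Proof.
move=> Kd dn xy xf yf; apply/funext => j; rewrite /faces; case: ltnP => // jn.
by have [? ?] := xy j; apply: face_adj; [lia|by []|by []|exact: xf|exact: yf].
Qed.

Lemma faces_le d x y j : K.+1 < d -> j < n -> faces d x = faces d y -> x j <= y j + H.
Proof.
move=> Kd jn /(congr1 (@^~ j)); rewrite /faces jn; apply: face_le; lia.
Qed.

End levels.

End near_skeleton.

(** Coordinates m-near the grid are rounded to multiples of 2^(m+1), which scaling by 2^k turns into
    multiples of 2^(k+m+1); only the at most k far ones can be off that grid. *)
Lemma Ywk_lattice (R : realType) (k m n : nat) (x : nat -> nat) :
  (far (2 ^ m.+1 * m.*2.+1) n m x <= k)%N -> (n <= k + m.+1)%N ->
  Ywk_part k (k + m.+1) (lattice n (2 ^+ k : R) (rnd m \o x)).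
Proof.
move=> xk nk; set i := (k + m.+1)%N in nk *; set v := lattice _ _ _.
have Z0 j : (0 : R) \in pow2Z j by rewrite inE mul0r int_num0.
have vE j : v j = if (j < n)%N then 2 ^+ k * (rnd m (x j))%:R else 0 by rewrite /v latticeE.
split.
  split=> j ij; rewrite vE; first by rewrite ltnNge (leq_trans nk ij).
  by case: ifP => _; [exact: pow2Z_nat|exact: Z0].
apply: leq_trans xk; rewrite cardE -(size_map val) /far -size_filter.
apply: uniq_leq_size; first by rewrite map_inj_uniq ?enum_uniq//; exact: val_inj.
move=> _ /mapP[j jP ->]; rewrite mem_enum in jP; rewrite mem_filter mem_iota /= add0n.
have {jP}jv : v j \notin pow2Z i := jP.
have jn : (j < n)%N by move: jv; rewrite vE; case: ifP => //; rewrite Z0.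
rewrite jn andbT; apply: contra jv => /near_rnd[q qE].
rewrite vE jn qE; have -> : 2 ^+ k * (q * 2 ^ m.+1)%:R = 2 ^+ i * q%:R :> R.
  by rewrite natrM natrX /i exprD [q%:R * _]mulrC mulrA.
exact: pow2Z_nat.
Qed.

(** * The colouring argument against covers of the skeleton *)

Section Y_lower.
Variables (R : realType) (K m : nat) (l : seq nat).
Let k := K.+1.
Let n := (K.+1 + m)%N.
Let h := (2 ^ m.+1)%N.
Let H := (h * m.*2.+1)%N.
Let Y : metricType R := Y2w R.
Hypothesis l_fine : forall c, (c < n)%N -> (2 ^ k <= nth 0 l c)%N.
Hypothesis l_coarse : forall c, (K < c)%N -> (c < n)%N -> (2 ^ k * H.+2 <= nth 0 l c)%N.

Let mH : (m.*2.+1 < H)%N.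
Proof. by rewrite /H -[X in (X < _)%N]mul1n ltn_pmul2r // /h expnS; have := ltn_pow2 m; lia. Qed.

Let adjacent (x y : nat -> nat) := forall j, (x j <= (y j).+1 /\ y j <= (x j).+1)%N.

Let low x := (far H n m x <= k)%N.

Section coloured.
Variables (pt : (nat -> nat) -> Y) (col : (nat -> nat) -> nat)
  (V : (nat -> nat) -> set Y) (U : nat -> set (set Y)) (D : R) (level : (nat -> nat) -> nat).
Hypothesis pt_index : forall x, low x -> Ylevel (pt x) = k /\ Yindex (pt x) = (k + m.+1)%N.
Hypothesis pt_vec : forall x, low x -> Yvec (pt x) = lattice n (2 ^+ k) (rnd m \o x).
Hypothesis coln : forall x, low x -> (col x < n)%N.
Hypothesis VU : forall x, low x -> U (col x) (V x) /\ V x (pt x).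
Hypothesis Ub : forall c A p q, (c < n)%N -> U c A -> A p -> A q -> mdist p q <= D.
Hypothesis D0 : 0 <= D.
Hypothesis Ud : forall c, (c < n)%N -> disjoint_family (nth 0%N l c)%:R (U c).
Hypothesis levelP : forall x, ~~ low x ->
  [/\ (k < level x)%N, (level x <= n)%N & isface H n (level x) x].

Lemma low_dist_le x y d : low x -> low y ->
  (forall j, (j < n)%N -> x j <= y j + d /\ y j <= x j + d)%N ->
  mdist (pt x) (pt y) <= 2 ^+ k * d%:R.
Proof.
move=> lx ly xy; have [lvx ixx] := pt_index lx; have [lvy ixy] := pt_index ly.
rewrite Y_distE lvx ixx lvy ixy !as_gapxx !addr0 !pt_vec//.
apply: lattice_dist_le => [|j jn]; first exact: exprn_ge0.
by have [xyj yxj] := xy j jn; split; exact: rnd_le.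
Qed.

Lemma coloured_absurd : False.
Proof.
pose F x := faces H n (level x) x.
pose nbr (d : nat) (G : nat -> nat) x := [/\ low x, col x = d.-1 &
  exists y, [/\ ~~ low y, level y = d, F y = G & adjacent x y]].
(* A point away from the skeleton inherits the label of a point of the skeleton
   that has its colour and touches its face, if there is one. *)
have /choice[rep repP] : forall dG : nat * (nat -> nat), exists x,
    (exists z, nbr dG.1 dG.2 z) -> nbr dG.1 dG.2 x.
  by move=> dG; have [[z nz]|nz] := pselect (exists z, nbr dG.1 dG.2 z); [exists z|exists id].
(* Levels in ]k, n] become the [m] coarse colours K + 1, ..., n - 1, colours being counted from
   0. *)
pose colour' x := if low x then col x else (level x).-1.
(* [inl] names a set of the given families, [inr] a face touched by no low point of its colour. *)
pose lab x : set Y + (nat -> nat) := if low x then inl (V x) else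
  if `[< exists z, nbr (level x) (F x) z >] then inl (V (rep (level x, F x))) else inr (F x).
have same_face x y j : ~~ low x -> ~~ low y -> level x = level y -> F x = F y ->
    (j < n)%N -> (x j <= y j + H)%N.
  move=> nx ny lxy Fxy jn; have [kx _ _] := levelP nx.
  apply: (@faces_le H n K m erefl mH (level x)) => //.
  by move: Fxy; rewrite /F lxy.
have colour'n x : (colour' x < n)%N.
  rewrite /colour'; case: ifPn => [/coln//|nx]; have [] := levelP nx; rewrite /k; lia.
(* At most H across the face, and 1 more to the representative. *)
have lab_inl x A : lab x = inl A -> exists z, [/\ low z, col z = colour' x, V z = A &
    forall j, (j < n)%N -> (x j <= z j + H.+1 /\ z j <= x j + H.+1)%N].
  rewrite /lab /colour'; case: ifPn => [lx [<-]|nx].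
    by exists x; split=> // j _; lia.
  case: ifPn => // /asboolP ex [<-]; exists (rep (level x, F x)).
  have [lz cz [y [ny ly Fy zy]]] := repP (_, _) ex; split=> // j jn.
  have := same_face _ _ _ nx ny (esym ly) (esym Fy) jn.
  have := same_face _ _ _ ny nx ly Fy jn.
  by have := zy j; lia.
(* [x] and the representative touch the same face, so they are within H + 2 of each other before
   scaling by 2^k; coarse disjointness puts them into one set. *)
have close x y : low x -> ~~ low y -> adjacent x y -> colour' x = colour' y ->
    lab x = lab y.
  move=> lx ny xy; rewrite /colour' lx (negbTE ny) => cxy.
  have ex : exists z, nbr (level y) (F y) z by exists x; split=> //; exists y; split.
  rewrite /lab lx (negbTE ny); move/asboolP: (ex) => ->; congr inl.
  have [lz cz [w [nw lw Fw zw]]] := repP (_, _) ex; set z := rep _ in lz cz zw *.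
  have [ky kn _] := levelP ny.
  have cn : ((level y).-1 < n)%N by move: ky kn; rewrite /k; lia.
  have [Ux Vx] := VU lx; have [Uz Vz] := VU lz; rewrite cxy in Ux; rewrite cz /= in Uz.
  apply: (disjoint_family_eq (Ud cn) Ux Uz Vx Vz).
  apply: (le_trans (low_dist_le (d := H.+2) lx lz _)) => [j jn|].
    have := same_face _ _ _ nw ny lw Fw jn; have := same_face _ _ _ ny nw (esym lw) (esym Fw) jn.
    by have := xy j; have := zw j; lia.
  by rewrite -natrX -natrM ler_nat; apply: l_coarse => //; move: ky; rewrite /k; lia.
(* Rounding shrinks the side M H to M h >= M; two detours of H + 1 to low points still leave a
   distance above [D]. *)
pose M := (Num.bound D + H.+2.*2)%N.
have [x xb|x y j xb yb jn x0 yN cxy lxy|x [y [xb yb xy cxy lxy]]] :=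
  @hex_box (M * H) n _ colour' lab; first exact: colour'n.
- case Ex : (lab x) => [A|G].
    have [z [lz cz Vz zx]] := lab_inl _ _ Ex; have [w [lw cw Vw wy]] : exists z, [/\ low z,
        col z = colour' y, V z = A & forall j, (j < n)%N -> (y j <= z j + H.+1 /\ z j <= y j + H.+1)%N].
      by apply: lab_inl; rewrite -lxy.
    have [Uz zV] := VU lz; have [Uw wV] := VU lw.
    have UA : U (colour' x) A by rewrite -Vz -cz.
    have Az : A (pt z) by rewrite -Vz.
    have Aw : A (pt w) by rewrite -Vw.
    have := Ub (colour'n x) UA Az Aw; apply/negP; rewrite -ltNge.
    apply: (@lt_le_trans _ _ ((rnd m (w j))%:R - (rnd m (z j))%:R)); last first.
      apply: le_trans (Yvec_le _ _); rewrite !pt_vec//.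
      have [wz|zw] := leqP (rnd m (w j)) (rnd m (z j)).
        by apply: le_trans (mdist_ge0 _ _); rewrite subr_le0 ler_nat.
      apply: le_trans (lattice_dist_ge _ _ _ jn); last exact: exprn_ge0.
      by rewrite ler_peMl ?subr_ge0 ?ler_nat 1?ltnW// exprn_ege1// ler1n.
    have := rnd_le m (zx j jn).2; rewrite x0 rnd0 add0n => rz.
    have := rnd_le m (wy j jn).1; rewrite yN rnd_grid => rw.
    have h0 : (0 < h)%N by rewrite expn_gt0.
    have Mh : (M <= M * h)%N by rewrite leq_pmulr.
    have : (Num.bound D + rnd m (z j) < rnd m (w j))%N by rewrite /M -/h in Mh rw *; lia.
    by rewrite -(ltr_nat R) natrD => H1; have := archi_boundP D0; lra.
  (* A label that is a face extends over at most H, less than the side of the box. *)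
  move: Ex lxy; rewrite /lab; case: ifPn => // nx; case: ifPn => // _ [_].
  case: ifPn => // ny; case: ifPn => // _ [Fxy].
  have lvxy : level y = level x.
    have [kx _ _] := levelP nx; have [ky _ _] := levelP ny.
    by move: cxy kx ky; rewrite /colour' (negbTE nx) (negbTE ny) /k; lia.
  have := same_face _ _ _ ny nx lvxy (esym Fxy) jn; rewrite x0 yN add0n /M.
  by apply/negP; rewrite -ltnNge ltn_Pmull //; [lia|exact: leq_ltn_trans mH].
(* Neighbours of one colour share the label: by fine disjointness if both are low, by [close] if one
   is, by equality of faces if none is. *)
- have [lx|nx] := boolP (low x); have [ly|ny] := boolP (low y).
  + apply: lxy; rewrite /lab lx ly; congr inl.
    have [Ux Vx] := VU lx; have [Uy Vy] := VU ly; rewrite /colour' lx ly in cxy.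
    rewrite -cxy in Uy; apply: (disjoint_family_eq (Ud (coln lx)) Ux Uy Vx Vy).
    apply: (le_trans (low_dist_le (d := 1) lx ly _)) => [j jn|].
      by have := xy j; lia.
    by rewrite mulr1 -natrX ler_nat; apply/l_fine/coln.
  + exact/lxy/close.
  + by apply: lxy; apply/esym/close => // j; have [] := xy j.
  + have lvxy : level x = level y.
      have [kx _ _] := levelP nx; have [ky _ _] := levelP ny.
      by move: cxy kx ky; rewrite /colour' (negbTE nx) (negbTE ny) /k; lia.
    have Fxy : F x = F y.
      have [kx xn xf] := levelP nx; have [_ _ yf] := levelP ny; rewrite -lvxy in yf.
      by rewrite /F -lvxy; apply: (@faces_adj H n K m erefl mH).
    by apply: lxy; rewrite /lab (negbTE nx) (negbTE ny) lvxy Fxy.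
Qed.

End coloured.
End Y_lower.

(** A cover by families at the scales [l] colours each point by the position in [l] of a family
    covering its rounded image, against [coloured_absurd]. *)
Lemma Y_Acoll (R : realType) (K m : nat) (l : seq nat) : size l = (K.+1 + m)%N ->
  (forall c, (c < K.+1 + m)%N -> (2 ^ K.+1 <= nth 0 l c)%N) ->
  (forall c, (K < c)%N -> (c < K.+1 + m)%N ->
     (2 ^ K.+1 * (2 ^ m.+1 * m.*2.+1).+2 <= nth 0 l c)%N) ->
  FinN [fset j in l]%fset -> Acoll (Y2w R) [fset j in l]%fset.
Proof.
move=> ln l_fine l_coarse sF; split=> // -[U0 [HU Uc]].
set n := (K.+1 + m)%N in ln l_fine l_coarse; pose H := (2 ^ m.+1 * m.*2.+1)%N.
have mH : (m.*2.+1 < H)%N by rewrite /H expnS; have := ltn_pow2 m; nia.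
have inl j : (j \in [fset j in l]%fset) = (j \in l) by rewrite in_fset.
have ls c : (c < n)%N -> nth 0%N l c \in [fset j in l]%fset.
  by move=> cn; rewrite inl mem_nth// ln.
have pt0 x : exists p : Y2w R, (far H n m x <= K.+1)%N ->
    [/\ Ylevel p = K.+1, Yindex p = (K.+1 + m.+1)%N & Yvec p = lattice n (2 ^+ K.+1) (rnd m \o x)].
  have nK : (n <= K.+1 + m.+1)%N by rewrite /n; lia.
  have ptx y : (far H n m y <= K.+1)%N -> exists p : Y2w R,
      [/\ Ylevel p = K.+1, Yindex p = (K.+1 + m.+1)%N & Yvec p = lattice n (2 ^+ K.+1) (rnd m \o y)].
    by move=> ylow; apply: Y_point => //; exact: Ywk_lattice.
  have [/ptx[p Hp]|xhigh] := boolP (far H n m x <= K.+1)%N; first by exists p.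
  (* The origin is low and supplies a default point of Y. *)
  have [|p _] := ptx (fun=> 0%N); last by exists p.
  rewrite /far (eq_count (a2 := pred0)) ?count_pred0// => j.
  by rewrite /= (@near_intro _ _ _ 0%N)//; lia.
have [pt ptE] := choice pt0.
have Ub i : exists D : R, i \in l -> forall A p q, U0 i A -> A p -> A q -> mdist p q <= D.
  have [il|] := boolP (i \in l); last by exists 0.
  have [|/uniformly_boundedP[D [_ HD]] _] := HU i; first by rewrite inl.
  by exists D => _; exact: HD.
have [D HD] := choice Ub.
have cV x : exists cV : nat * set (Y2w R),
    [/\ (cV.1 < n)%N, U0 (nth 0%N l cV.1) cV.2 & cV.2 (pt x)].
  have /seteqP[_ /(_ (pt x) I)[A [i /= il UA] Ax]] := Uc; rewrite inl in il.
  by exists (index i l, A); rewrite -ln index_mem /= nth_index.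
have [cV' cVP] := choice cV.
have lev x : exists d, (K.+1 < far H n m x)%N -> [/\ (K.+1 < d)%N, (d <= n)%N & isface H n d x].
  have [xl|] := boolP (K.+1 < far H n m x)%N; last by exists 0%N.
  by have [d Hd] := far_level (erefl n) mH xl; exists d.
have [level levelP] := choice lev.
apply: (@coloured_absurd R K m l l_fine l_coarse pt (fun x => (cV' x).1)
  (fun x => (cV' x).2) (fun c => U0 (nth 0%N l c)) (\sum_(i <- l) `|D i|) level).
- by move=> x /ptE[].
- by move=> x /ptE[].
- by move=> x _; have [] := cVP x.
- by move=> x _; have [] := cVP x.
- move=> c A p q cn UA Ap Aq; have cl : nth 0%N l c \in l by rewrite mem_nth// ln.
  apply: le_trans (HD _ cl _ _ _ UA Ap Aq) _; apply: le_trans (ler_norm _) _.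
  by rewrite (big_rem _ cl)//= lerDl sumr_ge0.
- exact: sumr_ge0.
- by move=> c /ls /HU[].
- by move=> x; rewrite -ltnNge => /levelP.
Qed.

(** [B] consists of K + 1 consecutive scales from 2^(K+1) on and is fixed before [m]; the other [m]
    scales start beyond the coarse threshold, which depends on [m]. *)
Lemma Y_trasdim_low (R : realType) K : exists B : {fset nat},
  [/\ #|` B| = K.+1, forall i, i \in B -> (0 < i)%N
    & forall m, exists s, [/\ Acoll (Y2w R) s, (B `<=` s)%fset & (m < #|` s|)%N]].
Proof.
pose b := (2 ^ K.+1)%N; have b0 : (0 < b)%N by rewrite expn_gt0.
exists [fset j in iota b K.+1]%fset; split.
- by rewrite card_fseq undup_id ?iota_uniq// size_iota.
- by move=> i; rewrite in_fset -[in_mem _ _]/(i \in iota b K.+1) mem_iota; lia.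
move=> m; pose c0 := (b * (2 ^ m.+1 * m.*2.+1).+2 + b + K.+1)%N.
have c0b : (b + K.+1 <= c0)%N by rewrite /c0 -[X in (_ <= X)%N]addnA leq_addl.
have c0H : (b * (2 ^ m.+1 * m.*2.+1).+2 <= c0)%N by rewrite /c0 -addnA leq_addr.
clearbody c0; pose l := iota b K.+1 ++ iota c0 m.
have lE j : (j \in [fset j in l]%fset) = ((b <= j < b + K.+1) || (c0 <= j < c0 + m))%N.
  by rewrite in_fset -[in_mem _ _]/(j \in l) mem_cat !mem_iota.
have nthl c : (c < K.+1 + m)%N ->
    nth 0%N l c = (if (c < K.+1)%N then b + c else c0 + (c - K.+1))%N.
  move=> cn; rewrite /l nth_cat size_iota; case: ltnP => cK; first by rewrite nth_iota.
  by rewrite nth_iota//; lia.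
have ul : uniq l.
  rewrite /l cat_uniq !iota_uniq andbT; apply/hasPn => j jc.
  have jb : (j \in iota b K.+1) = false by move: jc; rewrite !mem_iota; lia.
  by apply/negP; rewrite -[X in ~ is_true X]/(j \in iota b K.+1) jb.
exists [fset j in l]%fset; split.
- apply: (@Y_Acoll R K m).
  + by rewrite size_cat !size_iota.
  + by move=> c cn; rewrite nthl// -/b; case: ifP => _; lia.
  + by move=> c Kc cn; rewrite nthl// ltnNge Kc /= -/b (leq_trans c0H)// leq_addr.
  + split; first by move=> /fsetP/(_ b); rewrite lE in_fset0; lia.
    by move=> j; rewrite lE; lia.
- by apply/fsubsetP => j; rewrite lE in_fset -[in_mem _ _]/(j \in iota b K.+1) mem_iota => ->.
- by rewrite card_fseq undup_id// size_cat !size_iota; lia.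
Qed.

Theorem mainTheorem6 (R : realType) :
  let g : R -> nat := @g_fun R in
  [/\ forall r : R, 0 < r -> (ad (Y2w R) r < (g r)%:R%:E)%E,
      forall r : R, 1 < r -> ((g r)%:R%:E <= ad (Xw g) r)%E
    & exists alpha : tord,
        trasdim_eq (Xw g) alpha /\ trasdim_eq (Y2w R) (toadd alpha alpha)].
Proof.
move=> g; split; [exact: g_fun_lt_ad|exact: X_ad_ge|].
exists toomega; split; first exact: X_trasdim.
apply: trasdim_omega2; last exact: Y_trasdim_low.
by move=> a _; exact: Y_trasdim_up.
Qed.
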